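(* Determining if a given graph $G$ contains the butterfly as an induced minor can be done in time $\mathcal{O}(n^5m)$.
   Context: Graphs are finite, simple and undirected; $n=|V(G)|$ and $m=|E(G)|$, where, by a slight abuse of notation, $m$ in running-time bounds stands for $n+m$. $H$ is an induced minor of $G$ if a graph isomorphic to $H$ can be obtained from $G$ by vertex deletions and edge contractions. The butterfly is the graph obtained from two disjoint edges (on four vertices) by adding a fifth vertex adjacent to all four of them. *)

(* Defs.v *)
From mathcomp Require Import all_boot.

Set Implicit Arguments.
Unset Strict Implicit.
Unset Printing Implicit Defensive.

Record sgraph := SGraph {
  vertex :> finType;
  adj : rel vertex;
  adj_sym : symmetric adj;
  adj_irrefl : irreflexive adj
}.

Definition num_edges (G : sgraph) : nat :=
  #|[set [set p.1; p.2] | p : G * G & adj p.1 p.2]|.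

Definition isomorphic (H G : sgraph) : Prop :=
  exists2 f : H -> G, bijective f & forall x y, adj (f x) (f y) = adj x y.

Section Operations.
Variable G : sgraph.

Section Delete.
Variable v : G.

Definition delete_rel : rel {x : G | x != v} :=
  fun x y => adj (val x) (val y).

Lemma delete_sym : symmetric delete_rel.
Proof. by move=> x y; rewrite /delete_rel adj_sym. Qed.

Lemma delete_irrefl : irreflexive delete_rel.
Proof. by move=> x; rewrite /delete_rel adj_irrefl. Qed.

Definition delete_vertex : sgraph := SGraph delete_sym delete_irrefl.

End Delete.

(* The vertex [u] of the result stands for the contracted edge [uv]. *)
Section Contract.
Variables u v : G.

Definition contract_rel : rel {x : G | x != v} :=
  fun x y => (x != y) &&
    [|| adj (val x) (val y),
        (val x == u) && adj v (val y) |
        (val y == u) && adj v (val x)].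

Lemma contract_sym : symmetric contract_rel.
Proof.
by move=> x y; rewrite /contract_rel eq_sym adj_sym [X in _ || X]orbC.
Qed.

Lemma contract_irrefl : irreflexive contract_rel.
Proof. by move=> x; rewrite /contract_rel eqxx. Qed.

Definition contract_edge : sgraph := SGraph contract_sym contract_irrefl.

End Contract.

End Operations.

Inductive induced_minor (H : sgraph) : sgraph -> Prop :=
| IM_iso (G : sgraph) :
    isomorphic H G -> induced_minor H G
| IM_delete (G : sgraph) (v : G) :
    induced_minor H (delete_vertex v) -> induced_minor H G
| IM_contract (G : sgraph) (u v : G) :
    adj u v -> induced_minor H (contract_edge u v) -> induced_minor H G.

(* [Some (i, false)] -- [Some (i, true)], for [i : bool], are the two disjoint
   edges; [None] is the fifth vertex. *)
Definition butterfly_rel : rel (option (bool * bool)) :=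
  fun x y => match x, y with
  | Some (i, a), Some (j, b) => (i == j) && (a != b)
  | None, None => false
  | _, _ => true
  end.

Lemma butterfly_sym : symmetric butterfly_rel.
Proof. by do 2![case=> [[[] []]|]]. Qed.

Lemma butterfly_irrefl : irreflexive butterfly_rel.
Proof. by case=> [[[] []]|]. Qed.

Definition butterfly : sgraph := SGraph butterfly_sym butterfly_irrefl.

(* Running time is the number of instructions executed by a unit-cost RAM with
   words of [w] bits; for an input graph, [w] is O(log (n + m)), see
   [word_size]. *)

Inductive instr :=
| IConst (r k : nat)
| IAdd (r s t : nat)
| ISub (r s t : nat)
| IMul (r s t : nat)
| ILoad (r s : nat)
| IStore (r s : nat)
| IJump (l : nat)
| IJumpZero (r l : nat).

Definition program := seq instr.

Record config := Config {
  pc : nat;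
  reg : nat -> nat;
  memory : nat -> nat
}.

Definition upd (f : nat -> nat) (a x : nat) : nat -> nat :=
  fun b => if b == a then x else f b.

(* Arithmetic is modulo [2 ^ w], except that subtraction is truncated at 0;
   [IStore] needs no reduction, since registers
   only ever hold words. *)
Definition exec_instr (w : nat) (i : instr) (c : config) : config :=
  let: Config p R M := c in
  let set_reg r x := Config p.+1 (upd R r (x %% 2 ^ w)) M in
  match i with
  | IConst r k => set_reg r k
  | IAdd r s t => set_reg r (R s + R t)
  | ISub r s t => set_reg r (R s - R t)
  | IMul r s t => set_reg r (R s * R t)
  | ILoad r s => set_reg r (M (R s))
  | IStore r s => Config p.+1 R (upd M (R r) (R s))
  | IJump l => Config l R M
  | IJumpZero r l => Config (if R r == 0 then l else p.+1) R M
  end.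

(* The machine halts when the program counter leaves the program. *)
Definition halted (P : program) (c : config) : bool := size P <= pc c.

Definition step (w : nat) (P : program) (c : config) : config :=
  if halted P c then c else exec_instr w (nth (IJump 0) P (pc c)) c.

Definition initial (input : seq nat) : config :=
  Config 0 (fun=> 0) (nth 0 input).

Definition run (w : nat) (P : program) (input : seq nat) (t : nat) : config :=
  iter t (step w P) (initial input).

Definition adjacency_lists (G : sgraph) (N : G -> seq G) : Prop :=
  forall v, perm_eq (N v) (enum (adj v)).

(* n, m, then for each vertex in turn its degree followed by its neighbours,
   in any order; vertices are numbered from 0 to n - 1. *)
Definition graph_input (G : sgraph) (N : G -> seq G) : seq nat :=
  [:: #|G|, num_edges G &
    flatten [seq size (N v) :: [seq nat_of_ord (enum_rank u) | u <- N v]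
            | v <- enum G]].

Definition word_size (k : nat) (G : sgraph) : nat :=
  k * up_log 2 (#|G| + num_edges G).+2.

(* [P] accepts when register 0 is nonzero on halting.  The empty graph is
   exempted from the time bound (not from correctness) because [f 0 0] may
   be 0. *)
Definition decidable_in_time (L : sgraph -> Prop) (f : nat -> nat -> nat) :
    Prop :=
  exists (P : program) (k c : nat),
  forall (G : sgraph) (N : G -> seq G), adjacency_lists N ->
  exists t : nat,
    let final := run (word_size k G) P (graph_input N) t in
    [/\ halted P final,
        reg final 0 != 0 <-> L G &
        0 < #|G| -> t <= c * f #|G| (num_edges G)].

(* Main.v *)
Require Import Defs.
From mathcomp Require Import all_boot.
From mathcomp Require Import zify.

Set Implicit Arguments.
Unset Strict Implicit.
Unset Printing Implicit Defensive.

(** A butterfly induced minor can be normalised so that its four outer branch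
    sets are single vertices.  Let [B] be the central branch set and let [A],
    [A'] be the two sides of one wing.  Take a path in [A] and [A'] from a
    neighbour of [B] to a neighbour of [B], starting in [A] and ending in [A'],
    and move everything but its last two vertices into [B]: the centre stays
    connected, and the last edge of the path replaces the wing.  Its two ends
    still lie in the old wing, which has no edge to the other wing, and edges
    between the enlarged centre and the other wing do no harm ([pin_path]).  Doing this for both wings shows that [G] has a
    butterfly induced minor iff there are vertices [a], [b], [c], [d] inducing
    two disjoint edges [ab], [cd] and a connected component of [G] minus these
    four vertices in which each of the four has a neighbour
    ([induced_minor_butterflyP]).  The passage between sequences of deletions
    and contractions and branch sets holds for every pattern graph
    ([induced_minor_model], [model_induced_minor]).

    The algorithm tests this condition for all [n ^ 4] quadruples.  It first
    writes the adjacency matrix, after which the adjacency lists, and hence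
    [m], are irrelevant.  For a quadruple it labels the components of the rest
    of the graph by merging label classes along edges; a merge costs [O(n)],
    but each one destroys a label, so that there are at most [n] of them and the
    labelling costs [O(n ^ 2)] in total ([wp_merge]).  Another [O(n ^ 2)] steps
    look for a label seen by all four vertices.  This gives [O(n ^ 6)], which is
    at most [O(n ^ 5 (n + m))].

    To reason about machine code, the program is written in a small language of
    assignments, conditionals and counting loops.  Its semantics is a weakest
    precondition [wp] over unbounded integers with an explicit clock, which
    requires every computed value to fit in a word; [code_sound] transfers it to
    the compiled program, instruction count included. *)

(** * Branch-set models of induced minors *)
Lemma connect_map (S T : finType) (r : rel S) (e : rel T) (h : S -> T) :
  (forall x y, r x y -> connect e (h x) (h y)) ->
  forall x y, connect r x y -> connect e (h x) (h y).
Proof.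
move=> hre x y /connectP[p]; elim: p x => [|z p IHp] x /=.
  by move=> _ ->.
case/andP=> /hre hxz pzp ylast.
exact: connect_trans hxz (IHp _ pzp ylast).
Qed.

Definition within (G : sgraph) (A : {set G}) : rel G :=
  fun x y => [&& adj x y, x \in A & y \in A].

Definition connected (G : sgraph) (B : {set G}) : Prop :=
  {in B &, forall x y, connect (within B) x y}.

Definition fiber (G : sgraph) (K : eqType) (f : G -> option K) (h : K) : {set G} :=
  [set x | f x == Some h].

Lemma mem_fiber (G : sgraph) (K : eqType) (f : G -> option K) h x :
  reflect (f x = Some h) (x \in fiber f h).
Proof. by rewrite inE; apply: eqP. Qed.

Lemma connect_fiber (G : sgraph) (K : eqType) (f : G -> option K) h x y :
  connected (fiber f h) -> f x = Some h -> f y = Some h ->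
  connect (within (fiber f h)) x y.
Proof. by move=> + /mem_fiber fx /mem_fiber fy; apply. Qed.

Lemma within_connect_sym (G : sgraph) (A : {set G}) : connect_sym (within A).
Proof.
by apply: sym_connect_sym => x y; rewrite /within adj_sym [(x \in A) && _]andbC.
Qed.

(** The branch sets are encoded as the fibers of a partial labelling of [G] by
    the vertices of [H], which makes them disjoint by construction and lets
    deletions and contractions act by composition. *)
Definition branch_model (H G : sgraph) (f : G -> option H) : Prop :=
  [/\ forall h, exists x, f x = Some h,
      forall h, connected (fiber f h)
    & forall h k, h != k ->
        (exists x y, [/\ f x = Some h, f y = Some k & adj x y]) <-> adj h k].

(** Contracting [uv] is the retraction of [G] that sends [v] to [u]; it carries
    edges to edges or collapses them, and every edge of the contraction lifts. *)
Section Retraction.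
Variables (G : sgraph) (u v : G).
Hypothesis uv : adj u v.

Let neq_uv : u != v.
Proof. by apply: contraTneq uv => ->; rewrite adj_irrefl. Qed.

Definition squash (x : G) : contract_edge u v := insubd (Sub u neq_uv) x.

Lemma squash_val (z : contract_edge u v) : squash (val z) = z.
Proof. exact: valKd. Qed.

Lemma val_squash x : val (squash x) = if x == v then u else x.
Proof. by rewrite val_insubd; case: eqP. Qed.

Lemma squash_adj x y :
  squash x != squash y -> adj x y -> adj (squash x) (squash y).
Proof.
rewrite /= /contract_rel => -> xy /=; rewrite !val_squash.
case: (eqVneq x v) xy => [->|_]; case: (eqVneq y v) => [->|_] xy.
- by rewrite adj_irrefl in xy.
- by rewrite eqxx xy orbT.
- by rewrite eqxx (adj_sym v x) xy !orbT.
- by rewrite xy.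
Qed.

Lemma adj_unsquash (x y : contract_edge u v) :
  adj x y -> exists x' y', [/\ squash x' = x, squash y' = y & adj x' y'].
Proof.
rewrite /= /contract_rel => /andP[_].
case/or3P=> [xy|/andP[/eqP xu vy]|/andP[/eqP yu vx]].
- by exists (val x), (val y); rewrite !squash_val.
- exists v, (val y); rewrite squash_val; split=> //.
  by apply: val_inj; rewrite val_squash eqxx.
- exists (val x), v; rewrite squash_val adj_sym; split=> //.
  by apply: val_inj; rewrite val_squash eqxx.
Qed.

End Retraction.

Section Models.
Variable H : sgraph.
Implicit Type G : sgraph.

Lemma branch_model_iso G : isomorphic H G -> exists f : G -> option H, branch_model f.
Proof.
case=> f [g fK gK] f_adj; exists (fun x => Some (g x)); split.
- by move=> h; exists (f h); rewrite fK.
- move=> h x y /mem_fiber[<-] /mem_fiber[/(can_inj gK) ->].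
  exact: connect0.
- move=> h k _; split=> [[x [y [[<-] [<-]]]]|hk]; first by rewrite -f_adj !gK.
  by exists (f h), (f k); rewrite !fK f_adj.
Qed.

Lemma lift_model_delete G (v : G) (f : delete_vertex v -> option H) :
  branch_model f -> exists f' : G -> option H, branch_model f'.
Proof.
case=> f_onto f_conn f_adj.
pose f' (x : G) := obind (fun z : delete_vertex v => f z) (insub x).
have f'E (z : delete_vertex v) : f' (val z) = f z by rewrite /f' valK.
have f'S x h : f' x = Some h -> exists2 z : delete_vertex v, val z = x & f z = Some h.
  by rewrite /f'; case: insubP => //= z _ zx fz; exists z.
exists f'; split.
- by move=> h; have [z fz] := f_onto h; exists (val z); rewrite f'E.
- move=> h _ _ /mem_fiber/f'S[x <- fx] /mem_fiber/f'S[y <- fy].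
  have /connect_map := connect_fiber (f_conn h) (fx : f x = _) (fy : f y = _).
  apply=> z t /and3P[zt /mem_fiber fz /mem_fiber ft].
  by apply/connect1/and3P; split; [exact: zt | apply/mem_fiber; rewrite f'E ..].
- move=> h k hk; rewrite -(f_adj h k hk); split=> [|[x [y [fx fy xy]]]].
    by case=> _ [_ [/f'S[x <- fx] /f'S[y <- fy] xy]]; exists x, y.
  by exists (val x), (val y); rewrite !f'E.
Qed.

(** Pulling the labelling back along the retraction puts [v] into the branch
    set of [u]; the edge [uv] itself keeps that set connected. *)
Lemma lift_model_contract G (u v : G) (f : contract_edge u v -> option H) :
  adj u v -> branch_model f -> exists f' : G -> option H, branch_model f'.
Proof.
move=> uv [f_onto f_conn f_adj]; pose f' x := f (squash uv x).
have f'val x : f' (val x) = f x by rewrite /f' squash_val.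
have conn_squash x h : f' x = Some h ->
    connect (within (fiber f' h)) x (val (squash uv x)).
  move=> fx; rewrite val_squash; case: eqP => [xv|_]; last exact: connect0.
  have f'uv : f' u = f' v.
    by congr f; apply: val_inj; rewrite !val_squash eqxx; case: eqP.
  by apply/connect1/and3P; rewrite !inE xv f'uv -xv fx xv adj_sym.
exists f'; split=> [h|h x y /mem_fiber fx /mem_fiber fy|h k hk].
- by have [z fz] := f_onto h; exists (val z); rewrite f'val.
- apply: connect_trans (conn_squash _ _ fx) _.
  rewrite within_connect_sym; apply: connect_trans (conn_squash _ _ fy) _.
  rewrite within_connect_sym.
  have /connect_map := connect_fiber (f_conn h) (fx : f (squash uv x) = _) (fy : f (squash uv y) = _).
  apply=> z t.
  case/and3P=> /(adj_unsquash uv)[z' [t' [rz rt zt]]] /mem_fiber fz /mem_fiber ft.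
  rewrite -rz in fz *; rewrite -rt in ft *.
  apply: connect_trans (_ : connect _ _ z') _.
    by rewrite within_connect_sym conn_squash.
  apply: connect_trans (connect1 _) (conn_squash _ _ ft).
  by apply/and3P; split=> //; apply/mem_fiber.
- rewrite -(f_adj h k hk); split=> [[x [y [fx fy xy]]]|[x [y [fx fy]]]].
    exists (squash uv x), (squash uv y); split=> //; apply: squash_adj xy.
    by apply: contra_neq hk => rxy; apply: Some_inj; rewrite -fx -fy /f' rxy.
  case/(adj_unsquash uv)=> x' [y' [rx ry xy]].
  by exists x', y'; rewrite /f' rx ry.
Qed.

Lemma induced_minor_model G :
  induced_minor H G -> exists f : G -> option H, branch_model f.
Proof.
elim=> {G} [G|G v _ [f]|G u v uv _ [f]].
- exact: branch_model_iso.
- exact: lift_model_delete.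
- exact: lift_model_contract.
Qed.

Lemma restrict_model_delete G (v : G) (f : G -> option H) :
  f v = None -> branch_model f ->
  branch_model ((fun x => f (val x)) : delete_vertex v -> option H).
Proof.
move=> fv [f_onto f_conn f_adj].
have neq x h : f x = Some h -> x != v by apply: contra_eqN => /eqP ->; rewrite fv.
split=> [h|h x y /mem_fiber fx /mem_fiber fy|h k hk].
- by have [x fx] := f_onto h; exists (Sub x (neq _ _ fx)).
- pose r z : delete_vertex v := insubd x z.
  rewrite -[x](valKd x x : r (val x) = x) -[y](valKd x y : r (val y) = y).
  have /connect_map := connect_fiber (f_conn h) (fx : f (val x) = _) (fy : f (val y) = _).
  apply=> z t /and3P[zt /mem_fiber fz /mem_fiber ft].
  have rK z' : f z' = Some h -> val (r z') = z'.
    by rewrite /r val_insubd => /neq ->.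
  apply/connect1/and3P; split; [|by apply/mem_fiber; rewrite rK..].
  by rewrite /= /delete_rel !rK.
- rewrite -(f_adj h k hk); split=> [[x [y [fx fy xy]]]|[x [y [fx fy xy]]]].
    by exists (val x), (val y).
  by exists (Sub x (neq _ _ fx)), (Sub y (neq _ _ fy)).
Qed.

Lemma restrict_model_contract G (u v : G) (f : G -> option H) :
  adj u v -> f u = f v -> branch_model f ->
  branch_model ((fun x => f (val x)) : contract_edge u v -> option H).
Proof.
move=> uv fuv [f_onto f_conn f_adj].
have fsq x : f (val (squash uv x)) = f x.
  by rewrite val_squash; case: eqP => // ->.
split=> [h|h x y /mem_fiber fx /mem_fiber fy|h k hk].
- by have [x fx] := f_onto h; exists (squash uv x); rewrite fsq.
- rewrite -[x](squash_val uv) -[y](squash_val uv).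
  have /connect_map := connect_fiber (f_conn h) (fx : f (val x) = _) (fy : f (val y) = _).
  apply=> z t /and3P[zt /mem_fiber fz /mem_fiber ft].
  have [->|neq_zt] := eqVneq (squash uv z) (squash uv t); first exact: connect0.
  apply/connect1/and3P; split; first exact: squash_adj.
    by apply/mem_fiber; rewrite fsq.
  by apply/mem_fiber; rewrite fsq.
- rewrite -(f_adj h k hk); split=> [[x [y [fx fy]]]|[x [y [fx fy xy]]]].
    rewrite /= /contract_rel => /andP[_].
    case/or3P=> [xy|/andP[/eqP xu vy]|/andP[/eqP yu vx]].
    - by exists (val x), (val y).
    - by exists v, (val y); rewrite -fuv -xu.
    - by exists (val x), v; rewrite -fuv -yu adj_sym.
  exists (squash uv x), (squash uv y); rewrite !fsq; split=> //.
  apply: squash_adj xy; apply: contra_neq hk => rxy.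
  by apply: Some_inj; rewrite -fx -fy -fsq rxy fsq.
Qed.

(** As long as the labelling is not a bijection, an operation that preserves it
    makes the graph smaller: delete a vertex outside all branch sets, or
    contract an edge inside one.  If neither exists, connectedness forces all
    branch sets to be singletons, and the labelling is an isomorphism. *)
Lemma model_induced_minor G (f : G -> option H) :
  branch_model f -> induced_minor H G.
Proof.
have [k] := ubnP #|G|; elim: k G f => // k IHk G f ltGk mf.
have card_lt (v : G) : #|{: {x : G | x != v}}| < k.
  have G_gt0 : 0 < #|G| by apply/card_gt0P; exists v.
  by rewrite card_sig (@eq_card _ _ (predC1 v)) // cardC1; lia.
case: (pickP (fun v => f v == None)) => [v /eqP fv|fS].
  apply: (IM_delete (v := v)); apply: IHk (restrict_model_delete fv mf).
  exact: card_lt.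
case: (pickP (fun p : G * G => adj p.1 p.2 && (f p.1 == f p.2))) => [[u v] /= /andP[uv /eqP fuv]|f_inj].
  apply: (IM_contract uv); apply: IHk (restrict_model_contract uv fuv mf).
  exact: card_lt.
have [f_onto f_conn f_adj] := mf.
have inj_f x y h : f x = Some h -> f y = Some h -> x = y.
  move=> /mem_fiber fx /mem_fiber fy.
  have /connectP[[|z p] /=] := f_conn h x y fx fy; first by [].
  case/andP=> /and3P[xz /mem_fiber xh /mem_fiber zh] _.
  by have := f_inj (x, z); rewrite /= xz xh zh eqxx.
have preim h : {x | f x = Some h}.
  case: (pickP (fun x => f x == Some h)) => [x /eqP|no_x]; first by exists x.
  by exfalso; have [x /eqP] := f_onto h; rewrite no_x.
apply: IM_iso; pose g h := sval (preim h).
have gK h : f (g h) = Some h := svalP (preim h).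
have fP x : {h | f x = Some h}.
  by case fx: (f x) (fS x) => [h|//] _; exists h.
exists g.
  exists (fun x => sval (fP x)) => [h|x].
    by case: (fP (g h)) => h' /=; rewrite gK => -[->].
  by case: (fP x) => h /= fx; apply: inj_f fx.
move=> h h'; have [->|neq_h] := eqVneq h h'; first by rewrite !adj_irrefl.
apply/idP/idP => [gh|]; first by apply/(f_adj _ _ neq_h); exists (g h), (g h').
case/(f_adj _ _ neq_h)=> x [y [fx fy xy]].
by rewrite (inj_f _ _ _ (gK h) fx) (inj_f _ _ _ (gK h') fy).
Qed.

End Models.

(** * Normal form of a butterfly model *)
Definition touches (G : sgraph) (x : G) (B : {set G}) : Prop :=
  exists2 y, y \in B & adj x y.

(** The component is given by one of its vertices, [x], so that the condition is
    a finite quantification over vertices. *)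
Definition pinned (G : sgraph) (g : bool * bool -> G) (x : G) : Prop :=
  (forall p q, adj (g p) (g q) = (p.1 == q.1) && (p.2 != q.2)) /\
  forall p, exists2 y, connect (within [set z | z \notin codom g]) x y & adj (g p) y.

Section Pinning.
Variable G : sgraph.
Implicit Types (A B X : {set G}) (x y : G).

Lemma connect_withinS A B x y :
  A \subset B -> connect (within A) x y -> connect (within B) x y.
Proof.
move=> sAB; apply: (connect_map (h := id)) => {}x {}y /and3P[xy xA yA].
by apply: connect1; rewrite /within xy !(subsetP sAB).
Qed.

Lemma connected_add B x : connected B -> touches x B -> connected (x |: B).
Proof.
move=> B_conn [w wB xw].
have sB : B \subset x |: B by exact: subsetUr.
suff to_w y : y \in x |: B -> connect (within (x |: B)) y w.
  by move=> y z /to_w yw /to_w; rewrite within_connect_sym; exact: connect_trans.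
case/setU1P=> [->|yB]; last exact: connect_withinS sB (B_conn _ _ yB wB).
by apply: connect1; rewrite /within xw setU11 (subsetP sB).
Qed.

Lemma touchesS x A B : A \subset B -> touches x A -> touches x B.
Proof. by move=> /subsetP sAB [y /sAB yB xy]; exists y. Qed.

(** Absorb the first vertex of the path into the connected set: it touches it,
    and it is itself a neighbour of the next vertex.  Repeat until only the last
    edge of the path is left. *)
Lemma pin_path p x B :
    connected B -> path (@adj G) x p -> uniq (x :: p) -> p != [::] ->
    {in x :: p, forall y, y \notin B} ->
    touches x B -> touches (last x p) B ->
  exists a b B',
    [/\ a \in x :: p, b \in x :: p & adj a b] /\
    [/\ B \subset B', {in B', forall y, (y \in B) || (y \in x :: p)},
        connected B', a \notin B' /\ b \notin B' & touches a B' /\ touches b B'].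
Proof.
elim: p x B => // z [|z' p] IHp x B B_conn /andP[xz zp] uniq_p _ dis xB lastB.
  exists x, z, B; split; first by rewrite !inE !eqxx orbT.
  split=> //; last by split; apply: dis; rewrite !inE eqxx ?orbT.
  by move=> y ->.
have sB : B \subset x |: B by exact: subsetUr.
have /andP[x_notin uniq_zp] := uniq_p.
have [|||||||a [b [B' [[ap bp ab] [sB' B'P B'_conn nB' tB']]]]] := IHp z (x |: B).
- exact: connected_add.
- exact: zp.
- exact: uniq_zp.
- by [].
- move=> y yp; rewrite in_setU1 negb_or dis ?andbT; last by rewrite inE yp orbT.
  by apply: contraNneq x_notin => <-.
- by exists x; rewrite ?setU11 // adj_sym.
- exact: touchesS sB lastB.
exists a, b, B'; split; first by split; rewrite // inE ?ap ?bp orbT.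
split=> //; first exact: subset_trans sB'.
move=> y /B'P/orP[/setU1P[->|->]|yp]; first by rewrite mem_head orbT.
  by [].
by rewrite inE yp !orbT.
Qed.

Definition side (f : G -> option butterfly) (i : bool) : {set G} :=
  [set y | if f y is Some (Some p) then p.1 == i else false].

(** Both outer branch sets of a wing touch the centre, and they are joined by an
    edge, which yields the path wanted by [pin_path].  The centre is allowed to
    have grown to [B] already, as it has when the second wing is treated. *)
Lemma pin_side (f : G -> option butterfly) i B :
    branch_model f -> connected B -> fiber f None \subset B ->
    {in side f i, forall y, y \notin B} ->
  exists a b B',
    [/\ a \in side f i, b \in side f i & adj a b] /\
    [/\ B \subset B', {in B', forall y, (y \in B) || (y \in side f i)},
        connected B', a \notin B' /\ b \notin B' & touches a B' /\ touches b B'].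
Proof.
move=> [f_onto f_conn f_adj] B_conn /subsetP cB dis.
pose h b : butterfly := Some (i, b).
have touch b : exists2 x, f x = Some (h b) & touches x B.
  have [_ /(_ isT) [x [y [fx fy xy]]]] := f_adj (h b) None isT.
  by exists x => //; exists y => //; apply: cB; rewrite inE fy.
have [x fx xB] := touch false; have [y fy yB] := touch true.
have sideE z b : f z = Some (h b) -> z \in side f i by rewrite inE => ->; rewrite /= eqxx.
have sF b : fiber f (h b) \subset side f i.
  by apply/subsetP=> z /mem_fiber; apply: sideE.
have conn_side b z t : f z = Some (h b) -> f t = Some (h b) -> connect (within (side f i)) z t.
  move=> /mem_fiber fz /mem_fiber ft.
  exact: connect_withinS (sF b) (f_conn (h b) z t fz ft).
have neq_h : h false != h true by rewrite /h; case: (i).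
have [_ /(_ _) [|u [v [fu fv uv]]]] := f_adj _ _ neq_h; first by rewrite /= eqxx.
have [p xp [yp uniq_p]] : exists2 p, path (within (side f i)) x p & y = last x p /\ uniq (x :: p).
  suff /connectP[p xp ->] : connect (within (side f i)) x y.
    by case: (shortenP xp) => p' xp' up' _; exists p'.
  apply: connect_trans (conn_side _ _ _ fx fu) (connect_trans (connect1 _) (conn_side _ _ _ fv fy)).
  by rewrite /within uv (sideE u false) ?(sideE v true).
have p_side z : z \in x :: p -> z \in side f i.
  rewrite inE => /predU1P[->|zp]; first exact: sideE fx.
  elim: p {yp uniq_p} x {fx xB} xp zp => //= t p IHp x /andP[/and3P[_ _ ts] tp].
  by rewrite inE => /predU1P[->|]; last exact: IHp tp.
have [|||||a [b [B' [[ap bp ab] [sB' B'P B'_conn nB' tB']]]]] :=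
    @pin_path p x B B_conn _ uniq_p.
- by apply: sub_path xp => z t /and3P[].
- by apply: contra_eqN yp => /eqP ->; apply/eqP => /= yx; move: fy; rewrite yx fx.
- by move=> z /p_side/dis.
- exact: xB.
- by rewrite -yp.
exists a, b, B'; split; first by rewrite !p_side.
split=> // z /B'P/orP[->//|/p_side ->]; exact: orbT.
Qed.

Lemma model_pinned (f : G -> option butterfly) :
  branch_model f -> exists g x, @pinned G g x.
Proof.
move=> f_model; have [f_onto f_conn f_adj] := f_model.
have [||a [b [B [[aS bS ab] [sB BP B_conn [aB bB] [tA tb]]]]]] :=
    pin_side (i := false) f_model (f_conn None); first exact: subxx.
  by move=> y; rewrite !inE; case: (f y) => [[]|].
have [|c [d [C [[cS dS cd] [sC CP C_conn [cC dC] [tc td]]]]]] :=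
    pin_side (i := true) f_model B_conn sB.
  move=> y yS; apply/negP => /BP; move: yS; rewrite !inE.
  by case: (f y) => [[[[] []]|]|].
have side_neq y z : y \in side f false -> z \in side f true -> adj y z = false.
  rewrite !inE => fy fz; apply/negP => yz; move: fy fz.
  case fy: (f y) => [[[i b']|]|//] //; case fz: (f z) => [[[j c']|]|//] //.
  move=> /eqP /= i0 /eqP /= j1; subst i j.
  have [//|/(_ _) no_edge _] := f_adj (Some (false, b')) (Some (true, c')).
  by have := no_edge (ex_intro _ y (ex_intro _ z (And3 fy fz yz))).
have [x x_center] := f_onto None.
have notC y : y \in side f false -> y \notin B -> y \notin C.
  move=> yS yB; apply/negP => /CP; rewrite (negPf yB) /=.
  by move: yS; rewrite !inE; case: (f y) => [[[[] ?]|]|].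
pose g p := match p with
  | (false, false) => a | (false, true) => b
  | (true, false) => c | (true, true) => d end.
have gC p : g p \notin C by rewrite /g; case: p => [[] []] //; apply: notC.
have g_adj p q : adj (g p) (g q) = (p.1 == q.1) && (p.2 != q.2).
  rewrite /g; case: p q => [[] []] [[] []] /=; rewrite ?adj_irrefl //;
    by [rewrite side_neq | rewrite adj_sym // side_neq].
exists g, x; split=> // p.
have [y yC gy] : touches (g p) C.
  by rewrite /g; case: p => [[] []] //; apply: touchesS sC _.
exists y => //; apply: connect_withinS (C_conn _ _ _ yC).
  apply/subsetP => z zC; rewrite inE; apply/codomP => -[q zq].
  by move: (gC q); rewrite -zq zC.
by apply: (subsetP sC); apply: (subsetP sB); apply/mem_fiber.
Qed.

(** The centre is the whole component of [x] once the four vertices are removed.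
    The vertex [x] is itself none of these four: otherwise it would be isolated
    in the restricted graph and would have to be adjacent to itself. *)
Lemma pinned_model (g : bool * bool -> G) x :
  pinned g x -> exists f : G -> option butterfly, branch_model f.
Proof.
case=> g_adj g_touch; pose A := [set z | z \notin codom g].
have g_inj : injective g.
  move=> p q gpq; have := g_adj p (p.1, ~~ p.2); rewrite gpq g_adj /= eqxx.
  by case: p q {gpq} => [[] []] [[] []].
have gA p : g p \in A = false by rewrite inE codom_f.
have xA : x \in A.
  rewrite inE; apply/codomP => -[p xp]; have [y /connectP[[|z q] /=]] := g_touch p.
    by move=> _ ->; rewrite xp adj_irrefl.
  by rewrite /within xp gA andbF.
pose C := [set y | connect (within A) x y].
have sCA y : y \in C -> y \in A.
  rewrite inE => /connectP[p]; elim/last_ind: p => [|p z _] /=; first by move=> _ ->.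
  by rewrite rcons_path last_rcons => /andP[_ /and3P[_ _ ?]] ->.
have C_conn : connected C.
  have from_x y : y \in C -> connect (within C) x y.
    have xC : x \in C by rewrite inE connect0.
    have inC p t : t \in C -> path (within A) t p -> connect (within C) t (last t p).
      elim: p t => [|z p IHp] t tC /=; first by rewrite connect0.
      case/andP=> tz zp; have zC : z \in C.
        by rewrite !inE in tC *; apply: connect_trans tC (connect1 tz).
      apply: connect_trans (connect1 _) (IHp z zC zp).
      by case/and3P: tz => tz _ _; apply/and3P.
    by rewrite inE => /connectP[p xp ->]; apply: inC.
  move=> y z /from_x xy /from_x; apply: connect_trans.
  by rewrite within_connect_sym.
pose f y : option butterfly :=
  if y \in C then Some None else omap Some [pick p | g p == y].
have fC y : f y = Some None <-> y \in C.
  by rewrite /f; case: (y \in C) => //; split=> //; case: pickP.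
have fg p y : f y = Some (Some p) <-> y = g p.
  rewrite /f; split=> [|->].
    by case: (y \in C) => //; case: pickP => //= q /eqP <- [->].
  case: ifP => [/sCA|_]; first by rewrite gA.
  by case: pickP => [q /eqP/g_inj -> //|/(_ p)]; rewrite eqxx.
have touch_spokes p : exists y z, [/\ f y = Some None, f z = Some (Some p) & adj y z].
  have [y xy gy] := g_touch p; exists y, (g p); rewrite adj_sym gy.
  by split=> //; [apply/fC; rewrite inE | apply/fg].
exists f; split=> [[p|]|[p|]|[p|] [q|] neq_h //].
- by exists (g p); apply/fg.
- by exists x; apply/fC; rewrite inE connect0.
- by move=> y z /mem_fiber/fg -> /mem_fiber/fg ->; apply: connect0.
- move=> y z /mem_fiber/fC yC /mem_fiber/fC zC; apply: connect_withinS (C_conn _ _ yC zC).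
  by apply/subsetP=> t tC; apply/mem_fiber/fC.
- have -> : @adj butterfly (Some p) (Some q) = adj (g p) (g q).
    by rewrite g_adj /=; case: p q {neq_h} => [? ?] [? ?].
  split=> [[_ [_ [/fg -> /fg -> //]]]|pq].
  by exists (g p), (g q); split=> //; apply/fg.
- split=> _; first by case: (p).
  by have [y [z [fy fz yz]]] := touch_spokes p; exists z, y; rewrite adj_sym.
Qed.

Lemma induced_minor_butterflyP :
  induced_minor butterfly G <-> exists g x, @pinned G g x.
Proof.
split=> [/induced_minor_model[f]|[g [x /pinned_model[f]]]].
  exact: model_pinned.
exact: model_induced_minor.
Qed.

End Pinning.

(** * A structured language and its compiler *)
Inductive expr :=
| Var (x : nat)
| Const (k : nat)
| Plus (e f : expr)
| Minus (e f : expr)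
| Times (e f : expr)
| Deref (e : expr).

(** [For i e c] evaluates [e] once and runs [c] for [i] counting down from that
    value minus one to zero. *)
Inductive cmd :=
| Assign (x : nat) (e : expr)
| Write (a e : expr)
| Seq (c d : cmd)
| When (e : expr) (c : cmd)
| For (i : nat) (e : expr) (c : cmd).

Definition store := nat -> nat.

Fixpoint eval (e : expr) (R M : store) : nat :=
  match e with
  | Var x => R x
  | Const k => k
  | Plus e f => eval e R M + eval f R M
  | Minus e f => eval e R M - eval f R M
  | Times e f => eval e R M * eval f R M
  | Deref e => M (eval e R M)
  end.

Fixpoint cost (e : expr) : nat :=
  match e with
  | Var _ => 2
  | Const _ => 1
  | Plus e f | Minus e f | Times e f => (cost e + cost f).+1
  | Deref e => (cost e).+1
  end.

(** Only sums, products and constants can leave the range of words; registers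
    and memory cells always hold words, and subtraction is truncated. *)
Fixpoint fits (W : nat) (e : expr) (R M : store) : bool :=
  match e with
  | Var _ => true
  | Const k => k < W
  | Plus f g | Times f g =>
      [&& fits W f R M, fits W g R M & eval e R M < W]
  | Minus f g => fits W f R M && fits W g R M
  | Deref f => fits W f R M
  end.

(** Registers from [tmp] on are a stack of intermediate values. *)
Definition tmp := 16.

(** The value is left in register [t], and registers below [t] are preserved.
    A copy between registers is an addition of a freshly written zero. *)
Fixpoint code_expr (e : expr) (t : nat) : program :=
  match e with
  | Var x => [:: IConst t 0; IAdd t t x]
  | Const k => [:: IConst t k]
  | Plus e f => code_expr e t ++ code_expr f t.+1 ++ [:: IAdd t t t.+1]
  | Minus e f => code_expr e t ++ code_expr f t.+1 ++ [:: ISub t t t.+1]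
  | Times e f => code_expr e t ++ code_expr f t.+1 ++ [:: IMul t t t.+1]
  | Deref e => code_expr e t ++ [:: ILoad t t]
  end.

Fixpoint code (p : nat) (c : cmd) : program :=
  match c with
  | Assign x e => code_expr e tmp ++ [:: IConst tmp.+1 0; IAdd x tmp tmp.+1]
  | Write a e =>
      code_expr a tmp ++ code_expr e tmp.+1 ++ [:: IStore tmp tmp.+1]
  | Seq c d => let s := code p c in s ++ code (p + size s) d
  | When e c =>
      let start := (p + cost e).+1 in
      let body := code start c in
      code_expr e tmp ++ IJumpZero tmp (start + size body) :: body
  | For i e c =>
      let head := p + cost e + 2 in
      let body := code (head + 3) c in
      code_expr e tmp ++ [:: IConst tmp.+1 0; IAdd i tmp tmp.+1] ++
      [:: IJumpZero i (head + 3 + size body).+1; IConst tmp 1; ISub i i tmp] ++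
      body ++ [:: IJump head]
  end.

Fixpoint expr_scoped (e : expr) : bool :=
  match e with
  | Var x => x < tmp
  | Const _ => true
  | Plus e f | Minus e f | Times e f => expr_scoped e && expr_scoped f
  | Deref e => expr_scoped e
  end.

Fixpoint scoped (c : cmd) : bool :=
  match c with
  | Assign x e => (x < tmp) && expr_scoped e
  | Write a e => expr_scoped a && expr_scoped e
  | Seq c d => scoped c && scoped d
  | When e c => expr_scoped e && scoped c
  | For i e c => [&& i < tmp, expr_scoped e & scoped c]
  end.

(** A postcondition speaks of the clock, the registers and the memory. *)
Definition post := nat -> store -> store -> Prop.

(** The body must hand back its counter unchanged, since the compiled loop uses
    the same register to count. *)
Fixpoint loop (body : post -> post) (i k : nat) (Q : post) : post :=
  fun t R M =>
  if k is k'.+1 then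
    body (fun t R M => R i = k' /\ loop body i k' Q t.+1 R M)
      (t + 3) (upd R i k') M
  else Q t.+1 R M.

(** Weakest precondition, in continuation style.  The amounts added to the clock
    are the numbers of instructions executed by the compiled code. *)
Fixpoint wp (W : nat) (c : cmd) (Q : post) : post :=
  fun t R M =>
  match c with
  | Assign x e =>
      fits W e R M /\ Q (t + (cost e + 2)) (upd R x (eval e R M)) M
  | Write a e =>
      [/\ fits W a R M, fits W e R M &
          Q (t + (cost a + cost e + 1)) R (upd M (eval a R M) (eval e R M))]
  | Seq c d => wp W c (wp W d Q) t R M
  | When e c =>
      fits W e R M /\
      (if eval e R M == 0 then Q else wp W c Q) (t + (cost e + 1)) R M
  | For i e c =>
      fits W e R M /\
      loop (wp W c) i (eval e R M) Q (t + (cost e + 2))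
        (upd R i (eval e R M)) M
  end.

Section Soundness.
Variables (w : nat) (P : program).
Hypothesis w_gt0 : 0 < w.
Implicit Types (R M : store) (cfg : config).

Definition words M := forall x, M x < 2 ^ w.

Definition code_at p (s : program) := exists s1 s2, P = s1 ++ s ++ s2 /\ size s1 = p.

(** Registers from [tmp] on are free scratch space, so agreement is asked of the
    variables only. *)
Definition matches p R M cfg :=
  [/\ pc cfg = p, memory cfg = M & forall x, x < tmp -> reg cfg x = R x].

Lemma code_at_whole : code_at 0 P.
Proof. by exists [::], [::]; rewrite cats0. Qed.

Lemma code_at_cat p s1 s2 :
  code_at p (s1 ++ s2) -> code_at p s1 /\ code_at (p + size s1) s2.
Proof.
case=> r1 [r2 [PE <-]]; rewrite /code_at PE; split; first by exists r1, (s2 ++ r2); rewrite -catA.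
by exists (r1 ++ s1), r2; rewrite size_cat -!catA.
Qed.

Lemma step_at p i s cfg :
  code_at p (i :: s) -> pc cfg = p -> step w P cfg = exec_instr w i cfg.
Proof.
case=> [s1 [s2 [PE <-]]] pcE; rewrite /step /halted pcE PE size_cat /=.
by rewrite ifN; [rewrite nth_cat ltnn subnn | lia].
Qed.

Lemma words_upd M x k : words M -> k < 2 ^ w -> words (upd M x k).
Proof. by move=> WM ltk y; rewrite /upd; case: eqP. Qed.

Lemma one_word : 1 < 2 ^ w.
Proof. by rewrite -{1}(expn0 2) ltn_exp2l. Qed.

Lemma eval_word e R M : words R -> words M -> fits (2 ^ w) e R M -> eval e R M < 2 ^ w.
Proof.
move=> WR WM; elim: e => //= [e IHe f _|e IHe f _|e IHe f _].
- by case/and3P.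
- by case/andP=> /IHe lte _; apply: leq_ltn_trans (leq_subr _ _) lte.
- by case/and3P.
Qed.

Lemma size_code_expr e t : size (code_expr e t) = cost e.
Proof.
by elim: e t => //= [e IHe f IHf|e IHe f IHf|e IHe f IHf|e IHe] t;
  rewrite !size_cat IHe ?IHf /=; lia.
Qed.

Definition computes R M (s : nat -> program) n v := forall t p cfg,
    tmp <= t -> code_at p (s t) -> matches p R M cfg ->
  let cfg' := iter n (step w P) cfg in
  [/\ pc cfg' = p + n, memory cfg' = M, reg cfg' t = v
    & forall x, x < t -> reg cfg' x = reg cfg x].

Lemma computes_binop R M op f e1 e2 :
    (forall r x y cfg, exec_instr w (op r x y) cfg =
       Config (pc cfg).+1
         (upd (reg cfg) r (f (reg cfg x) (reg cfg y) %% 2 ^ w)) (memory cfg)) ->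
    computes R M (code_expr e1) (cost e1) (eval e1 R M) ->
    computes R M (code_expr e2) (cost e2) (eval e2 R M) ->
    f (eval e1 R M) (eval e2 R M) < 2 ^ w ->
  computes R M
    (fun t => code_expr e1 t ++ code_expr e2 t.+1 ++ [:: op t t t.+1])
    (cost e1 + cost e2).+1 (f (eval e1 R M) (eval e2 R M)).
Proof.
move=> opE IH1 IH2 ltf t p cfg let_t /code_at_cat[at1 /code_at_cat[at2 at3]].
rewrite !size_code_expr in at2 at3 => match0.
have [pc1 M1 v1 R1] := IH1 _ _ _ let_t at1 match0.
set cfg1 := iter _ _ _ in pc1 M1 v1 R1.
have match1 : matches (p + cost e1) R M cfg1.
  by split=> // x ltx; rewrite R1 ?(leq_trans ltx) //; case: match0 => _ _ ->.
have [pc2 M2 v2 R2] := IH2 _ _ _ (leqW let_t) at2 match1.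
set cfg2 := iter _ _ cfg1 in pc2 M2 v2 R2.
rewrite /= addnC iterD -/cfg1 -/cfg2 (step_at at3) // opE pc2 M2 v2 R2 // v1.
split=> //=; first by lia.
  by rewrite /upd eqxx modn_small.
by move=> x ltx; rewrite /upd ifN ?R2 ?R1 //; lia.
Qed.

Lemma code_expr_sound e R M :
    expr_scoped e -> words R -> words M -> fits (2 ^ w) e R M ->
  computes R M (code_expr e) (cost e) (eval e R M).
Proof.
move=> + WR WM; elim: e => [x|k|e1 IH1 e2 IH2|e1 IH1 e2 IH2|e1 IH1 e2 IH2|e IHe] sc fits_e.
- move=> t p cfg let_t at1 [pcE ME RE]; rewrite /= in sc at1 *.
  have [_ at2] := code_at_cat (at1 : code_at p ([:: IConst t 0] ++ [:: IAdd t t x])).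
  rewrite (step_at at1 pcE); case: cfg pcE ME RE => p' R' M' /= -> ME RE.
  rewrite (step_at at2) /= ?addn1 //; split=> //; first by rewrite addn2.
    by rewrite /upd !eqxx mod0n add0n ifN ?RE ?modn_small //; lia.
  by move=> y lty; rewrite /upd !ifN //; lia.
- move=> t p cfg let_t at1 [pcE ME RE]; rewrite /= in fits_e at1 *.
  rewrite (step_at at1 pcE); case: cfg pcE ME RE => p' R' M' /= <- ME RE.
  split=> //; first by rewrite addn1.
    by rewrite /upd eqxx modn_small.
  by move=> y lty; rewrite /upd ifN //; lia.
- case/andP: sc => sc1 sc2; case/and3P: fits_e => fits1 fits2 lt12.
  by apply: (@computes_binop R M IAdd addn); [move=> r x y [] | exact: IH1 | exact: IH2 |].
- case/andP: sc => sc1 sc2; have lt12 := eval_word WR WM fits_e.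
  case/andP: fits_e => fits1 fits2.
  by apply: (@computes_binop R M ISub subn); [move=> r x y [] | exact: IH1 | exact: IH2 |].
- case/andP: sc => sc1 sc2; case/and3P: fits_e => fits1 fits2 lt12.
  by apply: (@computes_binop R M IMul muln); [move=> r x y [] | exact: IH1 | exact: IH2 |].
- move=> t p cfg let_t /code_at_cat[at1 at2] match0; rewrite size_code_expr in at2.
  have [pc1 M1 v1 R1] := IHe sc fits_e _ _ _ let_t at1 match0.
  rewrite [cost _]/= iterS; set cfg1 := iter _ _ _ in pc1 M1 v1 R1 *.
  rewrite (step_at at2) //; case: cfg1 pc1 M1 v1 R1 => p' R' M' /= -> -> v1 R1.
  split=> //=; first by rewrite addnS.
    by rewrite /upd eqxx v1 modn_small.
  by move=> x ltx; rewrite /upd ifN ?R1 //; lia.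
Qed.

Definition reaches p (Q : post) t cfg := exists n cfg' R' M',
  [/\ iter n (step w P) cfg = cfg', matches p R' M' cfg', words R', words M'
    & Q (t + n) R' M'].

Lemma reaches_now p R M (Q : post) t cfg :
  matches p R M cfg -> words R -> words M -> Q t R M -> reaches p Q t cfg.
Proof. by exists 0, cfg, R, M; rewrite addn0. Qed.

Lemma reaches_iter p Q t n cfg :
  reaches p Q (t + n) (iter n (step w P) cfg) -> reaches p Q t cfg.
Proof.
case=> m [cfg' [R [M [<- match' WR WM QRM]]]].
by exists (m + n), (iter m (step w P) (iter n (step w P) cfg)), R, M; rewrite iterD addnA addnAC.
Qed.

Lemma reaches_trans p p' (Q Q' : post) t cfg :
  reaches p' Q' t cfg ->
  (forall t R M cfg, matches p' R M cfg -> words R -> words M -> Q' t R M ->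
     reaches p Q t cfg) ->
  reaches p Q t cfg.
Proof.
case=> n [cfg' [R [M [<- match' WR WM QRM]]]] /(_ _ _ _ _ match' WR WM QRM).
exact: reaches_iter.
Qed.

Lemma assign_sound x e p R M cfg :
    code_at p (code_expr e tmp ++ [:: IConst tmp.+1 0; IAdd x tmp tmp.+1]) ->
    x < tmp -> expr_scoped e -> words R -> words M -> fits (2 ^ w) e R M ->
    matches p R M cfg ->
  matches (p + (cost e + 2)) (upd R x (eval e R M)) M
    (iter (cost e + 2) (step w P) cfg).
Proof.
move=> /code_at_cat[at1 at2] ltx sc WR WM fits_e match0.
rewrite size_code_expr in at2.
have [pc1 M1 v1 R1] := code_expr_sound sc WR WM fits_e (leqnn _) at1 match0.
have v_word := eval_word WR WM fits_e.
rewrite [cost e + 2]addnC iterD; set cfg1 := iter _ _ cfg in pc1 M1 v1 R1 *.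
have [_ at3] := code_at_cat (at2 : code_at _ ([:: _] ++ [:: _])).
rewrite /= (step_at at2 pc1); case: cfg1 pc1 M1 v1 R1 => p' R' M' /= -> -> v1 R1.
rewrite (step_at at3) /= ?addn1 //; split=> //=; first by lia.
move=> y lty; rewrite /upd; case: eqP => // _; last first.
  by rewrite ifN ?R1 //; [case: match0 => _ _ ->| lia].
by rewrite eqxx mod0n addn0 /= v1 modn_small.
Qed.

(** Compiled code started in a state satisfying the weakest precondition reaches
    its end in a state satisfying the postcondition, at the clock time given by
    the number of machine steps. *)
Lemma code_sound c p (Q : post) t R M cfg :
    code_at p (code p c) -> scoped c -> words R -> words M ->
    matches p R M cfg -> wp (2 ^ w) c Q t R M ->
  reaches (p + size (code p c)) Q t cfg.
Proof.
elim: c p Q t R M cfg => [x e|a e|c IHc d IHd|e c IHc|i e c IHc] p Q t R M cfg /=.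
- move=> at0 /andP[ltx sc] WR WM match0 [fits_e Q1].
  have match1 := assign_sound at0 ltx sc WR WM fits_e match0.
  apply: (reaches_iter (n := cost e + 2)); apply: reaches_now Q1 => //.
    by rewrite size_cat size_code_expr.
  exact: words_upd (eval_word WR WM fits_e).
- move=> /code_at_cat[at1 /code_at_cat[at2 at3]] /andP[sca sce] WR WM match0.
  case=> fits_a fits_e Q1; rewrite !size_code_expr in at2 at3.
  have [pc1 M1 v1 R1] := code_expr_sound sca WR WM fits_a (leqnn _) at1 match0.
  set cfg1 := iter _ _ cfg in pc1 M1 v1 R1.
  have match1 : matches (p + cost a) R M cfg1.
    by split=> // x ltx; rewrite R1 //; case: match0 => _ _ ->.
  have [pc2 M2 v2 R2] := code_expr_sound sce WR WM fits_e (leqnSn _) at2 match1.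
  set cfg2 := iter _ _ cfg1 in pc2 M2 v2 R2.
  apply: (reaches_iter (n := cost a + cost e + 1)).
  have -> : iter (cost a + cost e + 1) (step w P) cfg = step w P cfg2.
    by rewrite addnC iterD [cost a + _]addnC iterD.
  rewrite (step_at at3 pc2).
  apply: reaches_now Q1 => //; last exact: words_upd (eval_word WR WM fits_e).
  case: cfg2 pc2 M2 v2 R2 => p' R' M' /= -> -> v2 R2; split=> /=.
  - by rewrite !size_cat !size_code_expr /=; lia.
  - by rewrite v2 R2 // v1.
  - by move=> x ltx; rewrite R2 ?R1 //; [case: match0 => _ _ -> | lia].
- move=> /code_at_cat[at1 at2] /andP[sc1 sc2] WR WM match0 wp1.
  rewrite size_cat addnA.
  apply: reaches_trans (IHc _ _ _ _ _ _ at1 sc1 WR WM match0 wp1) _.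
  by move=> t1 R1 M1 cfg1 match1 WR1 WM1; apply: IHd.
- set start := (p + cost e).+1; set body := code start c.
  move=> /code_at_cat[at1 at2] /andP[sce scc] WR WM match0 [fits_e wp1].
  rewrite size_code_expr in at2.
  have [pc1 M1 v1 R1] := code_expr_sound sce WR WM fits_e (leqnn _) at1 match0.
  set cfg1 := iter _ _ cfg in pc1 M1 v1 R1.
  have [_ at3] := code_at_cat (at2 : code_at _ ([:: _] ++ body)).
  have -> : p + size (code_expr e tmp ++ IJumpZero tmp (start + size body) :: body) =
            start + size body.
    by rewrite size_cat size_code_expr /= /start; lia.
  apply: (reaches_iter (n := cost e + 1)); rewrite [in iter _ _ _]addnC iterD -/cfg1.
  rewrite [iter 1 _ _]/=.
  rewrite (step_at at2 pc1).
  case: cfg1 pc1 M1 v1 R1 => p' R' M' /= -> -> v1 R1; rewrite v1.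
  have RE x : x < tmp -> R' x = R x by move=> ltx; rewrite R1 //; case: match0 => _ _ ->.
  case: eqP wp1 => _ wp1; first exact: reaches_now wp1.
  by apply: IHc wp1; rewrite // addn1 in at3.
- set head := p + cost e + 2; set body := code (head + 3) c.
  move=> at0 /and3P[lti sce scc] WR WM match0 [fits_e loop1].
  rewrite -[_ :: _]/([:: IConst tmp.+1 0; IAdd i tmp tmp.+1] ++ _) catA in at0.
  have [at1 at2] := code_at_cat at0.
  rewrite size_cat size_code_expr addnA -/head in at2.
  have [_ at3] := code_at_cat (at2 : code_at head ([:: _; _; _] ++ body ++ [:: _])).
  have [at4 at5] := code_at_cat at3.
  have match1 := assign_sound at1 lti sce WR WM fits_e match0.
  apply: (reaches_iter (n := cost e + 2)).
  rewrite (_ : p + size _ = (head + 3 + size body).+1); last first.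
    by rewrite !size_cat size_code_expr /= size_cat /= /head; lia.
  have WR1 := words_upd i WR (eval_word WR WM fits_e).
  have Ri : upd R i (eval e R M) i = eval e R M by rewrite /upd eqxx.
  move: match1 loop1; rewrite addnA -/head.
  (* only the loop head matters from here: induct on the remaining rounds *)
  clear fits_e match0 at0 at1; move: Ri WR1.
  move: (eval e R M) (iter _ _ cfg) (t + _) (upd R _ _) => k cfg1 t1 R1.
  clear cfg t R WR; elim: k t1 R1 cfg1 M WM => [|k IHk] t R cfg M WM Ri WR match0 /= loopQ.
    have [pcE ME RE] := match0.
    apply: (reaches_iter (n := 1)); rewrite /= (step_at at2 pcE) addn1.
    apply: reaches_now loopQ => //.
    by case: cfg pcE ME RE {match0} => /= p' R' M' _ -> RE; rewrite RE // Ri eqxx; split.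
  have match1 : matches (head + 3) (upd R i k) M (iter 3 (step w P) cfg).
    have [pcE ME RE] := match0; rewrite /= (step_at at2 pcE).
    have [_ at6] := code_at_cat (at2 : code_at head ([:: _] ++ [:: _; _] ++ body ++ [:: _])).
    have [_ at7] := code_at_cat (at6 : code_at _ ([:: _] ++ [:: _] ++ body ++ [:: _])).
    case: cfg pcE ME RE {match0} => /= p' R' M' -> -> RE; rewrite RE // Ri /=.
    rewrite [step w P (Config _ _ _)](step_at at6) /= ?addn1 //.
    rewrite [step w P (Config _ _ _)](step_at at7) /= ?addn1 //.
    split=> //=; first by rewrite addn3.
    move=> x ltx; rewrite /upd; have [_|neq_xi] := eqVneq x i; last first.
      by rewrite ifN ?RE //; lia.
    rewrite !eqxx ifN ?RE ?Ri //; last by lia.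
    rewrite (modn_small one_word) subn1 modn_small //=.
    by apply: leq_ltn_trans (WR i); rewrite Ri.
  apply: (reaches_iter (n := 3)).
  have WR1 : words (upd R i k).
    by apply: words_upd => //; apply: leq_ltn_trans (WR i); rewrite Ri.
  apply: reaches_trans (IHc _ _ _ _ _ _ at4 scc WR1 WM match1 loopQ) _.
  move=> t2 R2 M2 cfg2 match2 WR2 WM2 [R2i loop2].
  apply: (reaches_iter (n := 1)); rewrite addn1.
  apply: IHk loop2 => //; have [pcE ME RE] := match2; rewrite /= (step_at at5 pcE).
  by case: cfg2 pcE ME RE {match2} => p' R' M' _ /= -> RE; split.
Qed.

End Soundness.

(** * Program logic *)
Fixpoint written (c : cmd) : seq nat :=
  match c with
  | Assign x _ => [:: x]
  | Write _ _ => [::]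
  | Seq c d => written c ++ written d
  | When _ c => written c
  | For i _ c => i :: written c
  end.

Definition agree (xs : seq nat) (R R' : store) :=
  forall x, x \notin xs -> R' x = R x.

Section Rules.
Variable W : nat.
Implicit Types (Q : post) (R M : store).

Lemma wp_mono c Q Q' t R M :
  (forall t R M, Q t R M -> Q' t R M) -> wp W c Q t R M -> wp W c Q' t R M.
Proof.
elim: c Q Q' t R M => [x e|a e|c IHc d IHd|e c IHc|i e c IHc] Q Q' t R M QQ' /=.
- by case=> ? /QQ'.
- by case=> ? ? /QQ'.
- by apply: IHc => t1 R1 M1; apply: IHd.
- by case=> ? wp1; split=> //; case: eqP wp1 => _; [apply: QQ' | apply: IHc].
- case=> fits_e wp1; split=> //.
  move: (eval e R M) (t + _) (upd R i _) wp1 => k t1 R1.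
  elim: k t1 R1 M {fits_e} => /= [|k IHk] t1 R1 M1; first exact: QQ'.
  by apply: IHc => t2 R2 M2 [-> /IHk].
Qed.

Lemma wp_seq c d Q t R M : wp W c (wp W d Q) t R M -> wp W (Seq c d) Q t R M.
Proof. by []. Qed.

Lemma wp_frame_in xs R0 c Q t R M :
    {subset written c <= xs} -> agree xs R0 R -> wp W c Q t R M ->
  wp W c (fun t R' M => agree xs R0 R' /\ Q t R' M) t R M.
Proof.
have agree_upd x k R1 : x \in xs -> agree xs R0 R1 -> agree xs R0 (upd R1 x k).
  move=> xs_x R01 y y_xs; rewrite /upd; case: eqP => [yx|_]; last exact: R01.
  by rewrite yx xs_x in y_xs.
elim: c Q t R M => [x e|a e|c IHc d IHd|e c IHc|i e c IHc] Q t R M /= sub_xs R0R.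
- by case=> ? ?; split=> //; split=> //; apply: agree_upd => //; apply/sub_xs/mem_head.
- by case.
- have subc : {subset written c <= xs} by move=> x xc; apply: sub_xs; rewrite mem_cat xc.
  have subd : {subset written d <= xs} by move=> x xd; apply: sub_xs; rewrite mem_cat xd orbT.
  move/(IHc _ _ _ _ subc R0R); apply: wp_mono => t1 R1 M1 [R01 wpd].
  exact: IHd.
- by case=> ? wp1; split=> //; case: eqP wp1 => _ wp1; [| apply: IHc].
- case=> fits_e wp1; split=> //.
  have i_xs : i \in xs by apply/sub_xs/mem_head.
  have subc : {subset written c <= xs} by move=> x xc; apply: sub_xs; rewrite inE xc orbT.
  have {R0R} := agree_upd i (eval e R M) R i_xs R0R.
  move: (eval e R M) (t + _) (upd R i _) wp1 => k t1 R1.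
  elim: k t1 R1 M {fits_e} => /= [|k IHk] t1 R1 M1 wp1 R01 //.
  move: (IHc _ _ _ _ subc (agree_upd i k _ i_xs R01) wp1); apply: wp_mono.
  by move=> t2 R2 M2 [R02 [-> loop2]]; split=> //; apply: IHk.
Qed.

Lemma wp_frame c Q t R M :
  wp W c Q t R M ->
  wp W c (fun t R' M => agree (written c) R R' /\ Q t R' M) t R M.
Proof. exact: wp_frame_in. Qed.

Lemma agree_upd xs i k R R' : agree (i :: xs) R R' -> agree (i :: xs) R (upd R' i k).
Proof.
move=> RR' x x_xs; rewrite -RR' // /upd; case: eqP => // xi.
by rewrite xi mem_head in x_xs.
Qed.

(** Loop rule with an invariant [I] indexed by the number of remaining rounds and
    a potential [phi] on memory: [b] bounds the amortised cost of a round, and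
    each round takes four more instructions for the test, the decrement and the
    jump.  Registers not written by the loop are framed automatically. *)
Lemma wp_for i e c (I : nat -> store -> store -> Prop) (phi : store -> nat) b Q t R M :
    i \notin written c -> fits W e R M ->
    I (eval e R M) (upd R i (eval e R M)) M ->
    (forall k t1 R1 M1, k < eval e R M -> agree (i :: written c) R R1 -> I k.+1 R1 M1 ->
       wp W c (fun t2 R2 M2 => t2 + phi M2 <= t1 + phi M1 + b /\ I k R2 M2)
         t1 (upd R1 i k) M1) ->
    (forall t1 R1 M1,
       t1 + phi M1 <= t + phi M + (cost e + 3 + eval e R M * (b + 4)) ->
       agree (i :: written c) R R1 -> I 0 R1 M1 -> Q t1 R1 M1) ->
  wp W (For i e c) Q t R M.
Proof.
move=> i_c fits_e IN stepI finI; split=> //.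
set N := eval e R M in IN stepI finI *.
have loopN k t1 R1 M1 : k <= N -> agree (i :: written c) R R1 -> I k R1 M1 ->
    t1 + phi M1 + (1 + k * (b + 4)) <= t + phi M + (cost e + 3 + N * (b + 4)) ->
    loop (wp W c) i k Q t1 R1 M1.
  elim: k t1 R1 M1 => [|k IHk] t1 R1 M1 lekN RR1 Ik let1 /=.
    by apply: finI => //; lia.
  have RR1' : agree (i :: written c) R (upd R1 i k) by exact: agree_upd.
  have sub_c : {subset written c <= i :: written c} by move=> x xc; rewrite inE xc orbT.
  have := stepI k (t1 + 3) R1 M1 lekN RR1 Ik.
  move=> /(wp_frame_in sub_c RR1') /wp_frame.
  apply: wp_mono => t2 R2 M2 [R12 [RR2 [let2 Ik2]]]; split.
    by rewrite (R12 i i_c) /upd eqxx.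
  by apply: IHk => //; lia.
apply: loopN => //; [exact: agree_upd | lia].
Qed.

Fixpoint whens (es : seq expr) (c : cmd) : cmd :=
  if es is e :: es' then When e (whens es' c) else c.

Lemma wp_whens es c Q t R M :
    all (fun e => fits W e R M) es ->
    (forall t1, t1 <= t + sumn [seq (cost e).+1 | e <- es] ->
       if all (fun e => eval e R M != 0) es then wp W c Q t1 R M else Q t1 R M) ->
  wp W (whens es c) Q t R M.
Proof.
elim: es t => [|e es IHes] t /=; first by move=> _; apply; rewrite addn0.
case/andP=> fits_e fits_es wpc; split=> //; case: eqP wpc => /= e0 wpc.
  by apply: wpc; lia.
by apply: IHes => // t1 let1; apply: wpc; lia.
Qed.

Lemma written_whens es c : written (whens es c) = written c.
Proof. by elim: es. Qed.

End Rules.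

(** * The program *)
Definition vout := 0.
Definition vn := 1.
Definition vbase := 2.
Definition vlab := 3.
Definition va := 4.
Definition vb := 5.
Definition vc := 6.
Definition vd := 7.
Definition vx := 8.
Definition vy := 9.
Definition vq := 10.
Definition vold := 11.
Definition vnew := 12.
Definition vhit := 13.
Definition vpos := 14.
Definition vdeg := 15.

Definition entry (x y : nat) : expr :=
  Deref (Plus (Var vbase) (Plus (Times (Var x) (Var vn)) (Var y))).
(** The component labels are an array stored after the adjacency matrix. *)
Definition label_at (x : nat) : expr := Plus (Var vlab) (Var x).
Definition label (x : nat) : expr := Deref (label_at x).
Definition neg (e : expr) : expr := Minus (Const 1) e.
(** Truncated subtraction turns this into the distance of the two values. *)
Definition neq (e f : expr) : expr := Plus (Minus e f) (Minus f e).

(** The input occupies at most [n + 2 + n * n] cells; the matrix starts there. *)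
Definition preamble : cmd :=
  Seq (Assign vn (Deref (Const 0)))
  (Seq (Assign vbase (Plus (Times (Var vn) (Var vn)) (Plus (Var vn) (Const 2))))
       (Assign vlab (Plus (Var vbase) (Times (Var vn) (Var vn))))).

Definition read_neighbour : cmd :=
  Seq (Write (Plus (Var vbase) (Plus (Times (Var vx) (Var vn)) (Deref (Var vpos))))
             (Const 1))
      (Assign vpos (Plus (Var vpos) (Const 1))).

Definition read_list : cmd :=
  Seq (Assign vdeg (Deref (Var vpos)))
  (Seq (Assign vpos (Plus (Var vpos) (Const 1)))
  (Seq (For vq (Var vdeg) read_neighbour)
       (Assign vx (Plus (Var vx) (Const 1))))).

Definition read_graph : cmd :=
  Seq (Assign vpos (Const 2))
  (Seq (Assign vx (Const 0))
       (For vy (Var vn) read_list)).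

Definition relabel : cmd :=
  For vq (Var vn)
    (When (neg (neq (label vq) (Var vold))) (Write (label_at vq) (Var vnew))).

Definition unpinned (x : nat) : seq expr :=
  [seq neq (Var x) (Var p) | p <- [:: va; vb; vc; vd]].

Definition merge : cmd :=
  For vx (Var vn) (For vy (Var vn)
    (whens (entry vx vy :: unpinned vx ++ unpinned vy ++ [:: neq (label vx) (label vy)])
      (Seq (Assign vold (label vx)) (Seq (Assign vnew (label vy)) relabel)))).

Definition label_components : cmd :=
  Seq (For vx (Var vn) (Write (label_at vx) (Var vx))) merge.

Definition guard (k c : cmd) : cmd :=
  Seq (Assign vhit (Const 0)) (Seq k (When (Var vhit) c)).

Definition touch (p : nat) : cmd :=
  For vy (Var vn)
    (When (neg (neq (label vy) (label vx)))
      (When (entry p vy) (Assign vhit (Const 1)))).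

Definition accept : cmd := Assign vout (Const 1).

Definition check_center : cmd :=
  For vx (Var vn)
    (guard (touch va) (guard (touch vb) (guard (touch vc) (guard (touch vd) accept)))).

Definition induced_matching : seq expr :=
  [:: entry va vb; entry vc vd; neg (entry va vc); neg (entry va vd);
      neg (entry vb vc); neg (entry vb vd)].

Definition search_all : cmd :=
  For va (Var vn) (For vb (Var vn) (For vc (Var vn) (For vd (Var vn)
    (whens induced_matching (Seq label_components check_center))))).

Definition butterfly_cmd : cmd := Seq preamble (Seq read_graph search_all).

(** * Correctness of the program *)
Section Verification.
Variables (G : sgraph) (W : nat).
Implicit Types (R M : store) (Q : post) (rho : nat -> G).

Let n := #|G|.
Let base := n * n + (n + 2).
Let lab := base + n * n.
(* [lab + n] is the end of the label array and bounds every value computed. *)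
Hypothesis W_large : lab + n < W.

Definition rank (v : G) : nat := enum_rank v.

Lemma rank_lt v : rank v < n.
Proof. exact: ltn_ord. Qed.

Lemma rank_inj : injective rank.
Proof. by move=> u v /ord_inj/enum_rank_inj. Qed.

Lemma rank_onto k : k < n -> exists v, rank v = k.
Proof. by move=> ltk; exists (enum_val (Ordinal ltk)); rewrite /rank enum_valK. Qed.

Definition cell (u v : G) := base + (rank u * n + rank v).

Lemma cell_lt u v : cell u v < lab.
Proof.
rewrite ltn_add2l; have := rank_lt u; have := rank_lt v.
move: (rank u) (rank v) => i j ltj lti.
by apply: (@leq_trans (i * n + n)); [lia | rewrite -mulSnr leq_mul2r; lia].
Qed.

Lemma cell_inj u v u' v' : cell u v = cell u' v' -> u = u' /\ v = v'.
Proof.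
move/addnI => E; have n_gt0 : 0 < n by case: n (rank_lt u).
have := congr1 (modn^~ n) E; have := congr1 (divn^~ n) E.
rewrite /= !divnMDl // !modnMDl !divn_small ?rank_lt // !addn0 !modn_small ?rank_lt //.
by move=> /rank_inj -> /rank_inj.
Qed.

Definition layout R := [/\ R vn = n, R vbase = base & R vlab = lab].

Definition matrix M := forall u v, M (cell u v) = adj u v.

Definition lbl M (v : G) := M (lab + rank v).

(** The vertices currently chosen by the loops are a valuation [rho] of the loop
    registers. *)
Definition represents R (xs : seq nat) rho := {in xs, forall x, R x = rank (rho x)}.

Definition disjoint_from (xs ys : seq nat) := all (fun x => x \notin ys) xs.

Lemma layout_agree xs R R' :
  disjoint_from [:: vn; vbase; vlab] xs -> agree xs R R' -> layout R -> layout R'.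
Proof.
by case/and4P=> ? ? ? _ RR' [Rn Rb Rl]; split; rewrite RR'.
Qed.

Lemma represents_agree xs ys R R' rho :
  disjoint_from ys xs -> agree xs R R' -> represents R ys rho -> represents R' ys rho.
Proof. by move=> /allP dis RR' Rrho y yys; rewrite RR' ?Rrho // dis. Qed.

Lemma matrix_below M M' :
  (forall a, a < lab -> M' a = M a) -> matrix M -> matrix M'.
Proof. by move=> MM' mM u v; rewrite MM' ?cell_lt. Qed.

Definition tests e R M (b : bool) := fits W e R M /\ (eval e R M != 0) = b.

Lemma tests_entry R M x y u v :
  layout R -> matrix M -> R x = rank u -> R y = rank v ->
  tests (entry x y) R M (adj u v).
Proof.
move=> [Rn Rb Rl] mM Rx Ry; rewrite /tests /= Rn Rb Rx Ry mM; split; last by case: adj.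
by have := cell_lt u v; rewrite /cell; lia.
Qed.

Lemma tests_neq_var R M x y u v :
  R x = rank u -> R y = rank v -> tests (neq (Var x) (Var y)) R M (u != v).
Proof.
move=> Rx Ry; have := rank_lt u; have := rank_lt v; rewrite /tests /= Rx Ry => ltv ltu.
split; first by lia.
by rewrite -(inj_eq rank_inj); lia.
Qed.

Lemma fits_label R M x u :
  layout R -> R x = rank u -> fits W (label x) R M /\ eval (label x) R M = lbl M u.
Proof.
move=> [Rn Rb Rl] Rx; rewrite /= Rl Rx; split=> //.
by have := rank_lt u; lia.
Qed.

Lemma tests_neq e f R M :
  fits W e R M -> fits W f R M -> eval e R M < n -> eval f R M < n ->
  tests (neq e f) R M (eval e R M != eval f R M).
Proof.
by move=> fe ff lte ltf; rewrite /tests /= fe ff /=; split; lia.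
Qed.

Lemma tests_neg e R M b : tests e R M b -> tests (neg e) R M (~~ b).
Proof.
move=> [fe <-]; rewrite /tests /= fe; split; lia.
Qed.

Definition all_test es R M (b : bool) :=
  all (fun e => fits W e R M) es /\ all (fun e => eval e R M != 0) es = b.

Lemma all_test_nil R M : all_test [::] R M true.
Proof. by []. Qed.

Lemma all_test_cons e es R M b b' :
  tests e R M b -> all_test es R M b' -> all_test (e :: es) R M (b && b').
Proof. by move=> [fe <-] [fes <-]; split=> //; apply/andP. Qed.

Lemma all_test_cat es es' R M b b' :
  all_test es R M b -> all_test es' R M b' -> all_test (es ++ es') R M (b && b').
Proof. by move=> [fe <-] [fe' <-]; rewrite /all_test !all_cat fe fe'. Qed.

(** An exhaustive search as a specification: from memory satisfying [J], the
    command [c] raises the flag [o] iff [P] holds of the chosen vertices, never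
    lowers it, keeps [J], and takes at most [b] instructions.  Such
    specifications compose along the program text: conditionals become
    conjunctions and loops become existential quantifiers.  The numeric constants
    in the bounds below are the instruction counts that result. *)
Definition search (J : store -> Prop) (o : nat) (xs : seq nat)
    (P : (nat -> G) -> bool) (b : nat) (c : cmd) : Prop :=
  forall rho t R M Q, layout R -> J M -> represents R xs rho ->
    (forall t' R' M', t' <= t + b -> J M' -> agree (written c) R R' ->
       (R' o != 0) = (R o != 0) || P rho -> Q t' R' M') ->
  wp W c Q t R M.

Lemma one_lt : 1 < W.
Proof. by move: W_large; rewrite /lab /base; lia. Qed.

Lemma search_flag J o xs : search J o xs xpredT 3 (Assign o (Const 1)).
Proof.
move=> rho t R M Q _ JM _ finQ; split; first exact: one_lt.
apply: finQ => //; last by rewrite /upd eqxx orbT.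
by move=> x; rewrite inE => /negPf; rewrite /upd => ->.
Qed.

Lemma search_when J o xs p P b e c :
    (forall rho R M, layout R -> J M -> represents R xs rho -> tests e R M (p rho)) ->
    search J o xs P b c ->
  search J o xs (fun rho => p rho && P rho) (cost e + 1 + b) (When e c).
Proof.
move=> test_e sc rho t R M Q lR JM rR finQ.
have [fits_e pe] := test_e _ _ _ lR JM rR; split=> //.
case: eqP pe => e0 pe.
  by apply: finQ => //; [lia | rewrite -pe orbF].
apply: (sc rho) => // t' R' M' let' JM' RR' R'o.
by apply: finQ => //; [lia | rewrite R'o -pe].
Qed.

Lemma search_whens J o xs p P b es c :
    (forall rho R M, layout R -> J M -> represents R xs rho ->
       all_test es R M (p rho)) ->
    search J o xs P b c ->
  search J o xs (fun rho => p rho && P rho) (sumn [seq (cost e).+1 | e <- es] + b) (whens es c).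
Proof.
move=> test_es sc rho t R M Q lR JM rR finQ.
have [fits_es pes] := test_es _ _ _ lR JM rR; apply: wp_whens => // t1 let1.
rewrite written_whens in finQ; rewrite pes; case: ifP pes => pr _; last first.
  by apply: finQ => //; [lia | rewrite pr orbF].
apply: (sc rho) => // t' R' M' let' JM' RR' R'o.
by apply: finQ => //; [lia | rewrite R'o pr].
Qed.

(** The invariant is that the flag records the existence of a witness among the
    vertices already visited, which are those of largest rank because the counter
    runs downwards. *)
Lemma search_for J o xs P b i c :
    i \notin o :: written c -> disjoint_from ([:: vn; vbase; vlab] ++ xs) (i :: written c) ->
    search J o (i :: xs) P b c ->
  search J o xs (fun rho => [exists x, P [eta rho with i |-> x]])
    (5 + n * (b + 4)) (For i (Var vn) c).
Proof.
rewrite inE negb_or eq_sym => /andP[/negPf neq_oi i_c] dis sc rho t R M Q lR JM rR finQ.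
have [dis_l dis_x] : disjoint_from [:: vn; vbase; vlab] (i :: written c) /\
    disjoint_from xs (i :: written c) by apply/andP; rewrite -all_cat.
have Rn : R vn = n by case: lR.
pose rho' x : nat -> G := [eta rho with i |-> x].
apply: (@wp_for _ _ _ _ (fun k R1 M1 => J M1 /\
   (R1 o != 0) = (R o != 0) || [exists x, (k <= rank x) && P (rho' x)]) (fun=> 0) b) => //=.
- split=> //; rewrite /upd neq_oi Rn orbC.
  by case: existsP => // -[x]; have := rank_lt x; rewrite /n; lia.
- move=> k t1 R1 M1; rewrite Rn => ltk RR1 [JM1 R1o].
  have [x rx] := rank_onto ltk.
  have RR1' : agree (i :: written c) R (upd R1 i k) by exact: agree_upd.
  apply: (sc (rho' x)) => //.
  + exact: layout_agree RR1' lR.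
  + move=> y; rewrite inE /rho' /=; have [-> _|neq_yi /= yxs] := eqVneq y i.
      by rewrite /upd eqxx rx.
    by apply: (represents_agree dis_x RR1' rR).
  + move=> t2 R2 M2 let2 JM2 _ R2o; split; first by lia.
    split=> //; rewrite R2o /upd neq_oi R1o -orbA; congr (_ || _).
    apply/orP/existsP => [[/existsP[z /andP[ltz Pz]]|Px]|[z /andP[]]].
    * by exists z; rewrite Pz ltnW.
    * by exists x; rewrite rx leqnn.
    * rewrite leq_eqVlt -{1}rx => /orP[/eqP/rank_inj <- ->|ltz Pz]; first by right.
      by left; apply/existsP; exists z; rewrite ltz.
- move=> t1 R1 M1; rewrite Rn !addn0 => let1 RR1 [JM1 R1o].
  by apply: finQ => //; lia.
Qed.

(** A search that raises [vhit] serves as the condition of another search. *)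
Lemma search_guard J o xs p P b1 b2 k c :
    o != vhit -> o \notin written k ->
    disjoint_from ([:: vn; vbase; vlab] ++ xs) (vhit :: written k) ->
    search J vhit xs p b1 k -> search J o xs P b2 c ->
  search J o xs (fun rho => p rho && P rho) (6 + b1 + b2) (guard k c).
Proof.
move=> neq_o o_k dis sk sc rho t R M Q lR JM rR finQ.
have [dis_l dis_x] : disjoint_from [:: vn; vbase; vlab] (vhit :: written k) /\
    disjoint_from xs (vhit :: written k) by apply/andP; rewrite -all_cat.
split; first exact: ltnW one_lt.
set R0 := upd R vhit _.
have RR0 : agree [:: vhit] R R0.
  by move=> x; rewrite inE /R0 /upd => /negPf ->.
have RR0k : agree (vhit :: written k) R R0.
  by move=> x; rewrite inE negb_or => /andP[xh _]; rewrite RR0 ?inE.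
apply: (sk rho) => //.
  exact: represents_agree RR0k rR.
move=> t1 R1 M1 let1 JM1 RR1 R1h; rewrite [R0 _]/= [cost _]/= in let1 R1h.
have RR1k : agree (vhit :: written k) R R1.
  by move=> x x_hk; rewrite RR1 ?RR0k //; apply: contra x_hk; rewrite inE orbC => ->.
have R1o : R1 o = R o by apply: RR1k; rewrite inE negb_or neq_o.
rewrite eqxx /= in R1h; split=> //; rewrite [eval _ _ _]/= [cost _]/=.
case: eqP R1h => h0 R1h.
  apply: finQ => //; [lia| |by rewrite R1o -R1h orbF].
  move=> x /=; rewrite inE mem_cat => x_in; apply: RR1k.
  by rewrite inE; apply: contra x_in => /orP[->|->] //; rewrite orbT.
apply: (sc rho) => //.
- exact: layout_agree RR1k lR.
- exact: represents_agree RR1k rR.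
move=> t2 R2 M2 let2 JM2 RR2 R2o; apply: finQ => //; [lia| |by rewrite R2o R1o -R1h].
move=> x; rewrite /= inE !mem_cat !negb_or => /and3P[xh xk xc].
by rewrite RR2 // RR1k // inE negb_or xh.
Qed.

Lemma search_sub J o xs xs' P P' b b' c :
    {subset xs <= xs'} -> P =1 P' -> b <= b' ->
  search J o xs P b c -> search J o xs' P' b' c.
Proof.
move=> sub_xs PP' leb sc rho t R M Q lR JM rR finQ; apply: (sc rho) => //.
  by move=> x /sub_xs; apply: rR.
by move=> t1 R1 M1 let1 JM1 RR1 R1o; apply: finQ; rewrite -?PP' //; lia.
Qed.

Definition labelled (l : G -> nat) M := matrix M /\ forall v, lbl M v = l v.

Definition touched (l : G -> nat) (x u : G) := [exists y, (l y == l x) && adj u y].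

Section Labelled.
Variable l : G -> nat.
Hypothesis l_lt : forall v, l v < n.

Lemma search_touch p :
    p \in [:: va; vb; vc; vd] ->
  search (labelled l) vhit [:: vx; p] (fun rho => touched l (rho vx) (rho p))
    (5 + n * 50) (touch p).
Proof.
move=> p_in.
have p_vy : p != vy by apply: contraTneq p_in => ->.
have dis : disjoint_from [:: vx; p] (written (touch p)).
  by rewrite /= andbT; move: p_in; rewrite !inE => /or4P[] /eqP ->.
pose P (rho : nat -> G) :=
  (l (rho vy) == l (rho vx)) && (adj (rho p) (rho vy) && true).
(* a round costs 30 for the label test, 13 for the adjacency test and 3 for
   raising the flag *)
apply: (search_sub (xs := [:: vx; p]) (P := fun rho => [exists y, P [eta rho with vy |-> y]])
  (b := 5 + n * (46 + 4))) => //.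
- by move=> rho; apply: eq_existsb => y; rewrite /P /= (negPf p_vy) andbT.
apply: search_for => //.
- apply: (search_when (e := neg (neq (label vy) (label vx))) (b := 16)
    (p := fun rho => l (rho vy) == l (rho vx))
    (P := fun rho => adj (rho p) (rho vy) && true)) => [rho R M lR [mM lM] rR|].
    have Ry : R vy = rank (rho vy) by apply: rR.
    have Rx : R vx = rank (rho vx) by apply: rR.
    have [fy ey] := fits_label M lR Ry; have [fx ex] := fits_label M lR Rx.
    rewrite -[_ == _]negbK; apply: tests_neg; rewrite -!lM -ey -ex.
    by apply: tests_neq => //; rewrite ?ey ?ex lM.
  apply: (search_when (e := entry p vy) (b := 3) (p := fun rho => adj (rho p) (rho vy))
    (P := xpredT)) => [rho R M lR [mM lM] rR|]; last exact: search_flag.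
  have Ry : R vy = rank (rho vy) by apply: rR.
  have Rp : R p = rank (rho p) by apply: rR; rewrite !inE eqxx !orbT.
  exact: tests_entry.
Qed.

Lemma search_check_center :
  search (labelled l) vout [:: va; vb; vc; vd]
    (fun rho => [exists x, all (fun p => touched l x (rho p)) [:: va; vb; vc; vd]])
    (5 + n * (51 + n * 200)) check_center.
Proof.
pose tch p rho := touched l (rho vx) (rho p).
pose P rho := tch va rho && (tch vb rho && (tch vc rho && (tch vd rho && true))).
apply: (search_sub (xs := [:: va; vb; vc; vd]) (P := fun rho => [exists x, P [eta rho with vx |-> x]])
  (b := 5 + n * (47 + n * 200 + 4))) => //; first by lia.
apply: search_for => //.
have touch_x p : p \in [:: va; vb; vc; vd] ->
    search (labelled l) vhit [:: vx; va; vb; vc; vd] (tch p) (5 + n * 50) (touch p).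
  move=> p_in; apply: search_sub (search_touch p_in) => // x.
  rewrite mem_seq2 => /orP[] /eqP ->; first exact: mem_head.
  by rewrite in_cons p_in orbT.
apply: (search_sub (P := P) (xs := [:: vx; va; vb; vc; vd])); last first.
  apply: search_guard; [by []|by []|by []|exact: touch_x|].
  apply: search_guard; [by []|by []|by []|exact: touch_x|].
  apply: search_guard; [by []|by []|by []|exact: touch_x|].
  apply: search_guard; [by []|by []|by []|exact: touch_x|].
  exact: search_flag.
- lia.
- by [].
- by [].
Qed.

End Labelled.

Lemma lbl_upd M x z v : lbl (upd M (lab + rank x) z) v = if v == x then z else lbl M v.
Proof. by rewrite /lbl /upd eqn_add2l (inj_eq rank_inj). Qed.

Lemma upd_below M v z a : a < lab -> upd M (lab + rank v) z a = M a.
Proof. by move=> lta; rewrite /upd; case: eqP => // E; lia. Qed.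

Lemma wp_relabel t R M Q :
    layout R -> (forall v, lbl M v < n) -> R vold < n ->
    (forall t' R' M', t' <= t + (5 + n * 34) -> agree (written relabel) R R' ->
       (forall a, a < lab -> M' a = M a) ->
       (forall v, lbl M' v = if lbl M v == R vold then R vnew else lbl M v) ->
       Q t' R' M') ->
  wp W relabel Q t R M.
Proof.
move=> lR lM ltold finQ; have Rn : R vn = n by case: lR.
apply: (@wp_for _ _ _ _ (fun k R1 M1 => (forall a, a < lab -> M1 a = M a) /\
   forall v, lbl M1 v = if (k <= rank v) && (lbl M v == R vold) then R vnew
                        else lbl M v) (fun=> 0) 30) => //.
- by split=> // v; rewrite /= Rn leqNgt rank_lt.
- move=> k t1 R1 M1; rewrite [eval _ _ _]/= Rn => ltk RR1 [below1 lM1].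
  have [x rx] := rank_onto ltk.
  have RR1' : agree (written relabel) R (upd R1 vq k) by exact: agree_upd.
  have lR1 : layout (upd R1 vq k) by apply: layout_agree RR1' lR.
  have oldE : upd R1 vq k vold = R vold by apply: RR1'.
  have newE : upd R1 vq k vnew = R vnew by apply: RR1'.
  have [fx ex] := @fits_label (upd R1 vq k) M1 vq x lR1 (esym rx).
  have {}ex : eval (label vq) (upd R1 vq k) M1 = lbl M x by rewrite ex lM1 rx ltnn.
  have := @tests_neq (label vq) (Var vold) (upd R1 vq k) M1 fx isT.
  rewrite ex [eval (Var _) _ _]/= oldE => /(_ (lM x) ltold)/tests_neg.
  rewrite negbK => -[fe te]; split=> //.
  have finish z : (if lbl M x == R vold then R vnew else lbl M x) = z ->
      forall v, (if v == x then z else lbl M1 v) =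
        if (k <= rank v) && (lbl M v == R vold) then R vnew else lbl M v.
    move=> <- v; rewrite lM1; have [->|neq_vx] := eqVneq v x; first by rewrite rx leqnn.
    have -> // : (k <= rank v) = (k < rank v).
    by rewrite leq_eqVlt -rx (inj_eq rank_inj) eq_sym (negPf neq_vx).
  case: eqP te => e0 te.
    split; first by clear; rewrite /=; lia.
    split=> // v; rewrite -(finish (lbl M x)) -?te //.
    by case: eqP => // ->; rewrite lM1 rx ltnn.
  have addrE : eval (label_at vq) (upd R1 vq k) M1 = lab + rank x.
    by case: lR1 => _ _ /= ->; rewrite rx.
  split; [by case/and3P: fx => // | by [] | split; first by clear; rewrite /=; lia].
  rewrite addrE [eval (Var _) _ _]/= newE; split=> [a lta|v].
    by rewrite upd_below // below1.
  by rewrite lbl_upd (finish (R vnew)) // -te.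
- move=> t1 R1 M1; rewrite /= Rn !addn0 => let1 RR1 [below1 lM1].
  by apply: finQ => //; lia.
Qed.

Definition removed rho : {set G} :=
  [set z | z \notin [seq rho p | p <- [:: va; vb; vc; vd]]].

Lemma tests_unpinned R M x u rho :
    represents R [:: va; vb; vc; vd] rho -> R x = rank u ->
  all_test (unpinned x) R M (u \in removed rho).
Proof.
move=> rR Rx; rewrite /unpinned /all_test inE !all_map.
have test_p p : p \in [:: va; vb; vc; vd] -> tests (neq (Var x) (Var p)) R M (u != rho p).
  by move=> p_in; apply: tests_neq_var (rR p p_in).
split; first by apply/allP => p /test_p[ft _]; exact: ft.
apply/idP/negP => [/allP all_p /mapP[p p_in up]|not_p].
  have [_] := test_p p p_in.
  by rewrite (all_p p p_in : eval (neq _ _) _ _ != 0) up eqxx.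
apply/allP => p p_in; have [_] := test_p p p_in.
by move=> /= ->; apply/eqP => up; apply: not_p; apply/mapP; exists p.
Qed.

Definition classes M := size (undup (codom (lbl M))).

(** No new label appears, and [old] disappears. *)
Lemma classes_merge M M' old new :
    (exists u, lbl M u = old) -> (exists v, lbl M v = new) -> old != new ->
    (forall v, lbl M' v = if lbl M v == old then new else lbl M v) ->
  (classes M').+1 <= classes M.
Proof.
move=> [u lu] [v lv] neq_on lM'.
apply: (uniq_leq_size (s1 := old :: undup (codom (lbl M')))) => [|z].
  rewrite /= undup_uniq andbT mem_undup; apply/codomP => -[z].
  by rewrite lM'; case: eqP => [_ /eqP|/eqP + E]; rewrite ?(negPf neq_on) // -E eqxx.
rewrite in_cons !mem_undup => /predU1P[->|/codomP[t ->]]; first by rewrite -lu codom_f.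
by rewrite lM'; case: eqP => _; rewrite -?lv codom_f.
Qed.

(** With the potential [(5 + n * 34) * classes M], where [5 + n * 34] is the cost
    of one relabelling, processing a pair has constant amortised cost: a
    relabelling takes place only when it reduces the number of classes.  The
    constant is 137 for the ten tests and 16 for the two assignments. *)
Lemma wp_merge_pair rho x y t R M Q (e := within (removed rho)) :
    layout R -> matrix M -> represents R [:: va; vb; vc; vd] rho ->
    R vx = rank x -> R vy = rank y -> (forall v, lbl M v < n) ->
    (forall t' R' M', t' + (5 + n * 34) * classes M' <= t + (5 + n * 34) * classes M + 153 ->
      (forall a, a < lab -> M' a = M a) ->
      (forall v, lbl M' v = if e x y && (lbl M v == lbl M x) then lbl M y else lbl M v) ->
      Q t' R' M') ->
  wp W (whens (entry vx vy :: unpinned vx ++ unpinned vy ++ [:: neq (label vx) (label vy)])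
      (Seq (Assign vold (label vx)) (Seq (Assign vnew (label vy)) relabel))) Q t R M.
Proof.
move=> lR mM rR Rx Ry ltM finQ.
have [fx ex] := fits_label M lR Rx; have [fy ey] := fits_label M lR Ry.
have test_labels : tests (neq (label vx) (label vy)) R M (lbl M x != lbl M y).
  by rewrite -ex -ey; apply: tests_neq; rewrite ?ex ?ey.
have [fits_es test_es] := all_test_cons (tests_entry lR mM Rx Ry)
  (all_test_cat (tests_unpinned M rR Rx) (all_test_cat (tests_unpinned M rR Ry)
    (all_test_cons test_labels (all_test_nil R M)))).
apply: wp_whens => // t1 let1; rewrite test_es andbT !andbA -(andbA (adj x y)).
rewrite -[adj x y && _]/(e x y); have {}let1 : t1 <= t + 137 := let1.
case: ifP => [/andP[exy neq_xy]|no_merge]; last first.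
  apply: finQ => // [|v]; first by lia.
  by move: no_merge; case: (e x y) => //= /eqP ->; case: eqP => // ->.
split; first exact: fx.
set R1 := upd R vold _; have RR1 : agree [:: vold; vnew] R R1.
  by move=> z; rewrite inE negb_or => /andP[/negPf zo _]; rewrite /R1 /upd zo.
have R1y : R1 vy = rank y by rewrite RR1.
have lR1 : layout R1 by apply: layout_agree RR1 lR.
have [fy1 ey1] := fits_label M lR1 R1y; split; first exact: fy1.
rewrite ey1; set R2 := upd R1 vnew _.
have R2o : R2 vold = lbl M x by rewrite -ex.
have R2n : R2 vnew = lbl M y by [].
apply: wp_relabel => //; first by rewrite R2o.
move=> t2 R3 M' let2 _ below' lM'; rewrite R2o R2n in lM'.
apply: finQ => // [|v]; last by rewrite exy lM'.
have : (classes M').+1 <= classes M by apply: classes_merge lM' => //; [exists x | exists y].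
have {}let2 : t2 <= t1 + 8 + 8 + (5 + n * 34) := let2.
clear -let1 let2; move: (5 + n * 34) (classes M') (classes M) let1 let2 => K c c' let1 let2 ltc.
have : K * c + K <= K * c' by rewrite -mulnSr leq_mul2l ltc orbT.
lia.
Qed.

(** Soundness (equal labels are connected) holds throughout; completeness is
    accumulated one ordered pair at a time and survives later merges, which send
    equal labels to equal labels.  Once all edges have been processed, the labels
    are constant on components and separate them. *)
Lemma wp_merge rho t R M Q (e := within (removed rho)) :
    layout R -> matrix M -> represents R [:: va; vb; vc; vd] rho ->
    (forall v, lbl M v = rank v) ->
    (forall t' R' M', t' <= t + (5 + n * 34) * n + (5 + n * (9 + n * 157)) ->
      agree (written merge) R R' ->
      matrix M' -> (forall v, lbl M' v < n) ->
      (forall u v, (lbl M' u == lbl M' v) = connect e u v) ->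
      Q t' R' M') ->
  wp W merge Q t R M.
Proof.
move=> lR mM rR lM finQ; pose phi M' := (5 + n * 34) * classes M'.
pose good M' := [/\ matrix M', forall v, lbl M' v < n
  & forall u v, lbl M' u = lbl M' v -> connect e u v].
have good_merge x y M1 M2 : good M1 -> (forall a, a < lab -> M2 a = M1 a) ->
    (forall v, lbl M2 v = if e x y && (lbl M1 v == lbl M1 x) then lbl M1 y else lbl M1 v) ->
    good M2.
  move=> [mM1 lt1 sound1] below2 lM2; split.
  - exact: matrix_below below2 mM1.
  - by move=> v; rewrite lM2; case: ifP.
  - move=> u v; rewrite !lM2; case exy: (e x y) => /=; last exact: sound1.
    have cxy : connect e x y by exact: connect1.
    have sym_e := within_connect_sym (removed rho).
    case: eqP => [/sound1 ux|_]; case: eqP => [/sound1 vx_|_].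
    + by move=> _; apply: connect_trans ux _; rewrite sym_e.
    + by move/sound1=> yv; apply: connect_trans ux (connect_trans cxy yv).
    + move/sound1=> uy; apply: connect_trans uy _; rewrite sym_e.
      exact: connect_trans vx_ cxy.
    + exact: sound1.
pose merged M' x y := e x y -> lbl M' x = lbl M' y.
have keep_merged x y M1 M2 :
    (forall v, lbl M2 v = if e x y && (lbl M1 v == lbl M1 x) then lbl M1 y else lbl M1 v) ->
    merged M2 x y /\ forall u v, merged M1 u v -> merged M2 u v.
  move=> lM2; split=> [exy|u v].
    by rewrite !lM2 exy eqxx /=; case: eqP.
  by move=> muv /muv luv; rewrite !lM2 luv.
have Rn : R vn = n by case: lR.
apply: (@wp_for _ _ _ _ (fun k _ M1 => good M1 /\
   forall x y, k <= rank x -> merged M1 x y) phi (5 + n * 157)) => //.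
- rewrite /= Rn; split=> [|x y]; last by rewrite leqNgt rank_lt.
  split=> [//|v|u v]; first by rewrite lM rank_lt.
  by rewrite !lM => /rank_inj ->; apply: connect0.
- move=> k t1 R1 M1; rewrite [eval _ _ _]/= Rn => ltk RR1 [good1 merged1].
  have [x rx] := rank_onto ltk.
  have RR1' : agree (written merge) R (upd R1 vx k) by exact: agree_upd.
  have R1n : upd R1 vx k vn = n by rewrite RR1'.
  apply: (@wp_for _ _ _ _ (fun k' _ M2 => [/\ good M2,
     forall u v, k < rank u -> merged M2 u v &
     forall y, k' <= rank y -> merged M2 x y]) phi 153) => //.
  + by rewrite [eval _ _ _]/= R1n; split=> // y; rewrite leqNgt rank_lt.
  + move=> k' t2 R2 M2; rewrite [eval _ _ _]/= R1n => ltk' RR2 [good2 merged2 merged2x].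
    have [y ry] := rank_onto ltk'.
    have RR2' : agree (written merge) R (upd R2 vy k').
      move=> z z_in; have := z_in; rewrite /= !inE !negb_or => /and3P[zx zy z_r].
      rewrite /upd (negPf zy) RR2 ?RR1' //=.
      by rewrite !inE !negb_or zy.
    have R2x : upd R2 vy k' vx = rank x by rewrite /upd /= RR2 // rx.
    apply: (@wp_merge_pair rho x y) => //.
    * exact: layout_agree RR2' lR.
    * by case: good2.
    * by apply: represents_agree RR2' rR.
    * by case: good2.
    move=> t3 R3 M3 let3 below3 lM3.
    have [merged_xy keep] := keep_merged _ _ _ _ lM3.
    split=> //; split; first exact: good_merge good2 below3 lM3.
      by move=> u v ltk_u; apply/keep/merged2.
    move=> z; rewrite leq_eqVlt -{1}ry => /orP[/eqP/rank_inj <- //|ltz].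
    exact/keep/merged2x.
  + move=> t2 R2 M2; rewrite [eval _ _ _]/= R1n => let2 RR2 [good2 merged2 merged2x].
    split; first exact: let2.
    split=> // u v; rewrite leq_eqVlt -{1}rx => /orP[/eqP/rank_inj <-|ltu].
      exact: merged2x.
    exact: merged2.
- move=> t1 R1 M1; rewrite [eval _ _ _]/= [cost _]/= Rn => let1 RR1 [[mM1 lt1 sound1] merged1].
  apply: finQ => //.
    have : phi M <= (5 + n * 34) * n.
      rewrite leq_mul2l; apply/orP; right; apply: leq_trans (size_undup _) _.
      by rewrite size_codom.
    by clear -let1; move: (phi M) (phi M1) (_ * n) let1; lia.
  move=> u v; apply/eqP/idP => [/sound1 //|/connectP[p]].
  elim: p u => [|w p IHp] u /=; first by move=> _ ->.
  by case/andP=> uw wp vE; rewrite (merged1 u w) ?IHp.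
Qed.

Lemma wp_label_components rho t R M Q (e := within (removed rho)) :
    layout R -> matrix M -> represents R [:: va; vb; vc; vd] rho ->
    (forall t' R' M', t' <= t + (10 + n * (26 + n * 191)) ->
      agree (written label_components) R R' ->
      matrix M' -> (forall v, lbl M' v < n) ->
      (forall u v, (lbl M' u == lbl M' v) = connect e u v) ->
      Q t' R' M') ->
  wp W label_components Q t R M.
Proof.
move=> lR mM rR finQ; have Rn : R vn = n by case: lR.
apply: wp_seq; apply: (@wp_for _ _ _ _ (fun k _ M1 => matrix M1 /\
   forall v, k <= rank v -> lbl M1 v = rank v) (fun=> 0) 8) => //.
- by rewrite /= Rn; split=> // v; rewrite leqNgt rank_lt.
- move=> k t1 R1 M1; rewrite [eval _ _ _]/= Rn => ltk RR1 [mM1 lM1].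
  have [x rx] := rank_onto ltk.
  have RR1' : agree [:: vx] R (upd R1 vx k) by exact: agree_upd.
  have lR1 : layout (upd R1 vx k) by apply: layout_agree RR1' lR.
  have [fx _] := @fits_label (upd R1 vx k) M1 vx x lR1 (esym rx).
  have addrE : eval (label_at vx) (upd R1 vx k) M1 = lab + rank x.
    by case: lR1 => _ _ /= ->; rewrite rx.
  split=> //; split; first by clear; rewrite /=; lia.
  rewrite addrE [eval (Var _) _ _]/=; split.
    by apply: matrix_below mM1 => a lta; rewrite upd_below.
  move=> v; rewrite lbl_upd leq_eqVlt -{1}rx (inj_eq rank_inj) eq_sym.
  by case: eqP => [-> _|_ /lM1 //]; rewrite rx.
- move=> t1 R1 M1; rewrite [eval _ _ _]/= [cost _]/= Rn => let1 RR1 [mM1 lM1].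
  have RR1' : agree (written merge) R R1.
    move=> z z_in; apply: (RR1 : agree [:: vx] R R1).
    by apply: contra z_in; rewrite mem_seq1 => /eqP ->.
  apply: (@wp_merge rho) => //.
  + exact: layout_agree RR1' lR.
  + exact: represents_agree RR1' rR.
  + by move=> v; apply: lM1.
  move=> t2 R2 M2 let2 RR2 mM2 lt2 conn2; apply: finQ => //.
    by clear -let1 let2; nia.
  move=> z z_in; have {}z_in : z \notin written merge.
    by apply: contra z_in; apply: (@mem_behead _ (vx :: written merge)).
  by rewrite RR2 ?RR1'.
Qed.


(** The condition on the component, with [connect] oriented as the labels are
    compared. *)
Definition centered rho := [exists x, all (fun p =>
  [exists y, connect (within (removed rho)) y x && adj (rho p) y])
  [:: va; vb; vc; vd]].

Lemma search_centered :
  search matrix vout [:: va; vb; vc; vd] centered (15 + n * (77 + n * 391))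
    (Seq label_components check_center).
Proof.
move=> rho t R M Q lR mM rR finQ; apply: wp_seq; apply: (wp_label_components lR mM rR).
move=> t1 R1 M1 let1 RR1 mM1 lt1 conn1.
apply: (search_check_center lt1 (rho := rho)) => //.
- exact: layout_agree RR1 lR.
- exact: represents_agree RR1 rR.
move=> t2 R2 M2 let2 [mM2 _] RR2 R2o; apply: finQ => //.
- by clear -let1 let2; nia.
- move=> x x_in; have : x \notin written label_components ++ written check_center := x_in.
  by rewrite mem_cat negb_or => /andP[xl xc]; rewrite RR2 // RR1.
rewrite R2o (RR1 vout) //; congr (_ || _); apply: eq_existsb => x.
by apply: eq_all => p; apply: eq_existsb => y; rewrite conn1.
Qed.

Definition matching rho :=
  [&& adj (rho va) (rho vb), adj (rho vc) (rho vd),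
      ~~ adj (rho va) (rho vc), ~~ adj (rho va) (rho vd),
      ~~ adj (rho vb) (rho vc) & ~~ adj (rho vb) (rho vd)].

(** Four nested loops around the work done for one quadruple. *)
Definition search_cost := iter 4 (fun b => 5 + n * (b + 4)) (101 + n * (77 + n * 391)).

Lemma search_matching :
  search matrix vout [:: vd; vc; vb; va] (fun rho => matching rho && centered rho)
    (101 + n * (77 + n * 391)) (whens induced_matching (Seq label_components check_center)).
Proof.
apply: (search_whens (es := induced_matching) (p := matching) (P := centered)
  (b := 15 + n * (77 + n * 391))); last first.
  by apply: search_sub search_centered => // x; rewrite !inE; do 4!case: eqP => //.
move=> rho R M lR mM rR.
have test p q : p \in [:: vd; vc; vb; va] -> q \in [:: vd; vc; vb; va] ->
    tests (entry p q) R M (adj (rho p) (rho q)).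
  by move=> p_in q_in; apply: tests_entry => //; apply: rR.
rewrite /matching -[~~ adj (rho vb) (rho vd)]andbT.
by do !(apply: all_test_cons; [by [apply: test | apply/tests_neg/test] |]).
Qed.

Definition quad a b c d rho : nat -> G :=
  [eta [eta [eta [eta rho with va |-> a] with vb |-> b] with vc |-> c] with vd |-> d].

Lemma search_search_all :
  search matrix vout [::]
    (fun rho => [exists a, [exists b, [exists c, [exists d,
       matching (quad a b c d rho) && centered (quad a b c d rho)]]]])
    search_cost search_all.
Proof.
pose P4 rho := matching rho && centered rho.
pose P3 rho := [exists d, P4 [eta rho with vd |-> d]].
pose P2 rho := [exists c, P3 [eta rho with vc |-> c]].
pose P1 rho := [exists b, P2 [eta rho with vb |-> b]].
apply: (search_for (P := P1)) => //; apply: (search_for (P := P2)) => //.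
apply: (search_for (P := P3)) => //; apply: (search_for (P := P4)) => //.
exact: search_matching.
Qed.

(** The two descriptions of the four vertices, as the values of four registers
    and as an embedding of the two edges, are matched by [tag]. *)
Lemma pinned_quad rho0 :
  [exists a, [exists b, [exists c, [exists d,
     matching (quad a b c d rho0) && centered (quad a b c d rho0)]]]] <->
  exists g x, @pinned G g x.
Proof.
pose tag (p : bool * bool) := match p with
  | (false, false) => va | (false, true) => vb
  | (true, false) => vc | (true, true) => vd end.
have tag_in p : tag p \in [:: va; vb; vc; vd] by case: p => [[] []].
have tag_onto q : q \in [:: va; vb; vc; vd] -> exists p, q = tag p.
  rewrite !inE => /or4P[] /eqP ->; [exists (false, false)|exists (false, true)
    |exists (true, false)|exists (true, true)]; by [].
have removedE rho (g : bool * bool -> G) : (forall p, g p = rho (tag p)) ->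
    [set z | z \notin codom g] = removed rho.
  move=> gE; apply/setP => z; rewrite !in_set; congr (~~ _).
  apply/codomP/mapP => [[p ->]|[q /tag_onto[p ->] ->]].
    by exists (tag p); rewrite ?gE.
  by exists p; rewrite gE.
have adj_sym' (u v : G) : adj u v = adj v u by exact: adj_sym.
split.
  case/existsP=> a /existsP[b /existsP[c /existsP[d]]].
  set rho := quad a b c d rho0 => /andP[mat /existsP[x /allP cent]].
  pose g p := rho (tag p); exists g, x; split=> [p q|p].
    have {mat} : [&& adj a b, adj c d, ~~ adj a c, ~~ adj a d, ~~ adj b c & ~~ adj b d] := mat.
    case/and5P=> ab cd /negPf ac /negPf ad /andP[/negPf bc /negPf bd].
    have E : (g (false, false) = a) * (g (false, true) = b) *
             (g (true, false) = c) * (g (true, true) = d) by [].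
    have sym := (adj_sym' b a, adj_sym' c a, adj_sym' d a, adj_sym' c b, adj_sym' d b, adj_sym' d c).
    by case: p q => [[] []] [[] []]; rewrite !E ?adj_irrefl // ?sym ?(ab, cd, ac, ad, bc, bd).
  have /existsP[y /andP[yx gy]] := cent _ (tag_in p).
  by exists y; rewrite // (removedE rho) // within_connect_sym.
case=> g [x [g_adj g_touch]].
pose a := g (false, false); pose b := g (false, true).
pose c := g (true, false); pose d := g (true, true).
apply/existsP; exists a; apply/existsP; exists b.
apply/existsP; exists c; apply/existsP; exists d.
set rho := quad a b c d rho0.
have gE p : g p = rho (tag p) by case: p => [[] []].
have rhoE : (rho va = a) * (rho vb = b) * (rho vc = c) * (rho vd = d) by [].
apply/andP; split; first by rewrite /matching !rhoE !g_adj.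
apply/existsP; exists x; apply/allP => q /tag_onto[p ->].
have [y xy gy] := g_touch p; apply/existsP; exists y.
by rewrite -gE gy -(removedE _ _ gE) within_connect_sym xy.
Qed.

(** Without vertices there is no valuation of the registers, but then the outer
    loop is empty. *)
Lemma wp_search_all t R M Q :
    layout R -> matrix M -> R vout = 0 ->
    (forall t' R' M', t' <= t + search_cost ->
       R' vout != 0 <-> (exists g x, @pinned G g x) -> Q t' R' M') ->
  wp W search_all Q t R M.
Proof.
move=> lR mM R0 finQ; case: (posnP n) => [n0|n_gt0]; last first.
  have [x0 _] := rank_onto n_gt0; pose rho0 (_ : nat) := x0.
  apply: (search_search_all (rho := rho0)) => // t1 R1 M1 let1 mM1 _ R1o.
  by apply: finQ => //; rewrite R1o R0 /=; exact: pinned_quad.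
have Rn : R vn = 0 by case: lR => ->.
apply: (@wp_for _ _ _ _ (fun _ R1 _ => R1 vout = 0) (fun=> 0) 0) => //.
  by move=> k t1 R1 M1; rewrite /= Rn.
move=> t1 R1 M1; rewrite [eval _ _ _]/= Rn [cost _]/= => let1 _ R1o; apply: finQ.
  by move: let1; rewrite /search_cost /=; lia.
by rewrite R1o; split=> // -[g [x _]]; have := rank_lt x; rewrite n0.
Qed.

(** ** Reading the adjacency lists *)
Section Reading.
Variable N : G -> seq G.
Hypothesis NP : adjacency_lists N.

Definition record (v : G) : seq nat := size (N v) :: [seq rank u | u <- N v].

Let X := graph_input N.

Lemma mem_adjacency u v : (v \in N u) = adj u v.
Proof. by rewrite (perm_mem (NP u)) mem_enum. Qed.

Lemma size_adjacency v : size (N v) <= n.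
Proof. by rewrite (perm_size (NP v)) -cardE max_card. Qed.

Lemma inputE : X = [:: n, num_edges G & flatten [seq record v | v <- enum G]].
Proof. by []. Qed.

Lemma size_input : size X <= base.
Proof.
rewrite inputE /= size_flatten /shape -map_comp sumnE big_map.
apply: (@leq_trans (\sum_(v <- enum G) n.+1).+2).
  rewrite !ltnS; apply: leq_sum => v _ /=; rewrite size_map ltnS.
  exact: size_adjacency.
rewrite big_const_seq count_predT iter_addn_0 -cardE -/n /base; lia.
Qed.

Lemma drop_enum v : drop (rank v) (enum G) = v :: drop (rank v).+1 (enum G).
Proof. by rewrite (drop_nth v) ?nth_enum_rank // -cardE rank_lt. Qed.

Lemma read_head p (s : seq nat) k : drop p X = k :: s ->
  [/\ nth 0 X p = k, drop p.+1 X = s & p < base].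
Proof.
move=> dropE; have ltp : p < size X.
  by rewrite ltnNge; apply: contra_eqN dropE => /drop_oversize ->.
have := drop_nth 0 ltp; rewrite dropE => -[kE sE]; split; rewrite -?kE -?sE //.
exact: leq_trans ltp size_input.
Qed.

Lemma cell_upd M u v u' v' k :
  upd M (cell u v) k (cell u' v') = if (u' == u) && (v' == v) then k else M (cell u' v').
Proof.
rewrite /upd; case: eqP => [/cell_inj[-> ->]|neq_c]; first by rewrite !eqxx.
by case: eqP => // uu; case: eqP => // vv; case: neq_c; rewrite uu vv.
Qed.

Definition input_kept M := forall a, a < base -> M a = nth 0 X a.

Definition rows_before k M := forall u v, M (cell u v) = (rank u < k) && adj u v.

(** The part of the input still to be read is tracked as a suffix of it, so that
    no position in the flattened lists has to be computed.  Matrix cells not yet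
    written are zero, the value of memory beyond the input. *)
Lemma wp_read_list x t R M Q rest :
    layout R -> R vx = rank x -> drop (R vpos) X = record x ++ rest ->
    input_kept M -> rows_before (rank x) M ->
    (forall t' R' M', t' <= t + (22 + n * 24) -> agree (written read_list) R R' ->
       R' vx = (rank x).+1 -> drop (R' vpos) X = rest ->
       input_kept M' -> rows_before (rank x).+1 M' -> Q t' R' M') ->
  wp W read_list Q t R M.
Proof.
move=> lR Rx dropE keptM rowsM finQ; have lab_W := W_large.
have [headE dropE1 ltp] := read_head dropE.
apply: wp_seq; split=> //; set R1 := upd R vdeg _.
have R1n : R1 vdeg = size (N x) by rewrite /R1 /upd /= keptM.
apply: wp_seq; split.
  by rewrite /= one_lt /= /R1 /upd /=; move: lab_W; rewrite /lab; lia.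
set R2 := upd R1 vpos _.
have R2o : drop (R2 vpos) X = [seq rank u | u <- N x] ++ rest by rewrite /R2 /upd /= addn1.
have lR2 : layout R2 by case: lR.
apply: wp_seq; apply: (@wp_for _ _ _ _ (fun k R3 M3 => exists done todo,
  [/\ N x = done ++ todo, size todo = k,
     drop (R3 vpos) X = [seq rank u | u <- todo] ++ rest, input_kept M3 &
     forall u v, M3 (cell u v) = if u == x then v \in done : nat else
                                 (rank u < rank x) && adj u v]) (fun=> 0) 20) => //.
- exists [::], (N x); split=> // u v.
  by rewrite rowsM; case: eqP => // ->; rewrite ltnn.
- move=> k t3 R3 M3 ltk RR3 [done [[|y todo] [NE sz drop3 kept3 rows3]]] //.
  case: sz => sz.
  have [head3 drop4 ltp3] := read_head drop3.
  have lR3 : layout (upd R3 vq k).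
    by apply: (layout_agree _ (agree_upd k RR3) lR2).
  have R3x : upd R3 vq k vx = rank x by rewrite /upd /= RR3.
  have addrE : eval (Plus (Var vbase) (Plus (Times (Var vx) (Var vn)) (Deref (Var vpos))))
      (upd R3 vq k) M3 = cell x y.
    case: lR3 => /= -> -> _; rewrite R3x; congr (_ + (_ + _)).
    by rewrite kept3.
  have lt_xy := cell_lt x y.
  apply: wp_seq; split.
  + by case: lR3 addrE => /= -> -> _; rewrite R3x /cell => addrE; rewrite /cell in lt_xy; lia.
  + exact: one_lt.
  rewrite addrE; split.
    by rewrite /= one_lt /= /upd /=; move: lab_W; rewrite /lab; lia.
  split; first by clear; rewrite /=; lia.
  exists (rcons done y), todo; split=> //.
  + by rewrite cat_rcons.
  + by rewrite /upd /= addn1.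
  + by move=> a lta; rewrite -kept3 // /upd; case: eqP => // aE; move: lta; rewrite aE /cell; lia.
  + move=> u v; rewrite cell_upd rows3 mem_rcons inE.
    by case: (u == x) => //=; case: (v == y).
- move=> t3 R3 M3; rewrite [eval _ _ _]/= (R1n : R2 vdeg = _) => let3 RR3 [done [todo]].
  case=> NE /size0nil todo0; rewrite todo0 /= => drop3 kept3 rows3.
  rewrite todo0 cats0 in NE.
  split; first by rewrite /= one_lt /= RR3 // /R2 /R1 /upd /= Rx; have := rank_lt x; lia.
  apply: finQ => //.
  + have {}let3 : t3 <= t + 5 + 6 + (5 + size (N x) * 24).
      by move: let3; rewrite !addn0.
    have := size_adjacency x; clear -let3.
    by move: (size (N x)) let3 => d let3 led; nia.
  + move=> z z_in; have : z \notin [:: vdeg; vpos; vq; vpos; vx] := z_in.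
    rewrite !inE !negb_or => /and5P[zn zo zq _ zx].
    rewrite /upd (negPf zx) RR3 ?inE ?negb_or ?zq //.
    by rewrite /R2 /R1 /upd (negPf zo) (negPf zn).
  + by rewrite /upd /= RR3 // /R2 /R1 /upd /= Rx addn1.
  + move=> u v; rewrite rows3 -NE mem_adjacency ltnS [rank u <= _]leq_eqVlt (inj_eq rank_inj).
    by case: eqP => [->|].
Qed.

Lemma wp_read_graph R M t Q :
    layout R -> (forall a, M a = nth 0 X a) ->
    (forall t' R' M', t' <= t + (11 + n * (26 + n * 24)) ->
       agree (written read_graph) R R' -> matrix M' -> Q t' R' M') ->
  wp W read_graph Q t R M.
Proof.
move=> lR MX finQ; have lab_W := W_large.
apply: wp_seq; split; first by rewrite /=; move: lab_W; rewrite /lab /base; lia.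
apply: wp_seq; split; first exact: ltnW one_lt.
set R2 := upd (upd R vpos _) vx _.
have Rn : R2 vn = n by case: lR.
apply: (@wp_for _ _ _ _ (fun k R3 M3 => [/\ R3 vx = n - k,
  drop (R3 vpos) X = flatten [seq record v | v <- drop (n - k) (enum G)],
  input_kept M3 & rows_before (n - k) M3]) (fun=> 0) (22 + n * 24)) => //.
- rewrite [eval _ _ _]/= Rn subnn; split=> //.
  + by rewrite drop0 /R2 /upd /= drop0.
  + move=> u v; rewrite MX nth_default //; apply: leq_trans size_input _.
    by rewrite /cell; lia.
- move=> k t3 R3 M3; rewrite [eval _ _ _]/= Rn => ltk RR3 [R3x drop3 kept3 rows3].
  have [x rx] : exists x, rank x = n - k.+1 by apply: rank_onto; lia.
  have nk : n - k = (rank x).+1 by rewrite rx; lia.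
  apply: (@wp_read_list x _ _ _ _ (flatten [seq record v | v <- drop (n - k) (enum G)])) => //.
  + apply: (layout_agree _ (agree_upd k RR3)) => //.
  + by rewrite rx.
  + by rewrite /upd /= drop3 -rx drop_enum nk.
  + by rewrite rx.
  move=> t4 R4 M4 let4 RR4 R4x drop4 kept4 rows4.
  by rewrite -nk in R4x rows4; rewrite !addn0.
- move=> t3 R3 M3; rewrite [eval _ _ _]/= [cost _]/= Rn !addn0 => let3 RR3 [_ _ _ rows3].
  apply: finQ.
  + by move: let3; clear; rewrite /=; lia.
  + move=> z z_in; have : z \notin [:: vpos, vx, vy & written read_list] := z_in.
    rewrite 3!(in_cons, negb_or) => /and4P[zo zx zy z_r].
    rewrite RR3 /R2 /upd ?(negPf zo) ?(negPf zx) //.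
    by rewrite inE negb_or zy.
  + by move=> u v; rewrite rows3 subn0 rank_lt.
Qed.

Lemma wp_butterfly_cmd Q :
    (forall t R M, t <= 37 + n * (26 + n * 24) + search_cost ->
       R vout != 0 <-> (exists g x, @pinned G g x) -> Q t R M) ->
  wp W butterfly_cmd Q 0 (fun=> 0) (nth 0 X).
Proof.
move=> finQ; have lab_W := W_large; do 2!apply: wp_seq.
split; first by rewrite /=; move: lab_W; rewrite /lab /base; lia.
apply: wp_seq; split.
  rewrite /= /upd /=; move: lab_W; rewrite /lab /base /n.
  by clear; move: #|_| => k; lia.
split.
  rewrite /= /upd /=; move: lab_W; rewrite /lab /base /n.
  by clear; move: #|_| => k; lia.
apply: wp_seq; apply: wp_read_graph => //.
move=> t R M let1 RR mM; apply: wp_search_all => //.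
- by apply: layout_agree RR _.
- by rewrite RR.
move=> t2 R2 M2 let2 R2o; apply: finQ => //.
have {}let1 : t <= 26 + (11 + n * (26 + n * 24)) := let1.
lia.
Qed.


End Reading.
End Verification.

(** ** Word size and running time *)
Lemma word_size_large (G : sgraph) : (#|G| + num_edges G).+2 ^ 3 <= 2 ^ word_size 3 G.
Proof. by rewrite /word_size mulnC expnM leq_exp2r // up_logP. Qed.

(** Each loop raises the degree by one; its overhead of at most [9 * n] adds nine
    to the leading constant. *)
Lemma search_cost_bound (G : sgraph) : 0 < #|G| -> search_cost G <= 605 * #|G| ^ 6.
Proof.
rewrite /search_cost; move: #|G| => n n_gt0.
have step b c j : b <= c * n ^ j -> 5 + n * (b + 4) <= (c + 9) * n ^ j.+1.
  move=> leb; have : n * b <= c * n ^ j.+1 by rewrite expnS mulnCA leq_mul2l leb orbT.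
  have : n <= n ^ j.+1 by rewrite expnS leq_pmulr // expn_gt0 n_gt0.
  lia.
have b0 : 101 + n * (77 + n * 391) <= 569 * n ^ 2.
  by rewrite expnS expn1; nia.
exact: step (step _ _ _ (step _ _ _ (step _ _ _ b0))).
Qed.

Lemma words_input (G : sgraph) (N : G -> seq G) w :
  adjacency_lists N -> (#|G| + num_edges G).+2 <= 2 ^ w -> words w (nth 0 (graph_input N)).
Proof.
move=> NP ltW a; have : all (fun k => k < 2 ^ w) (graph_input N).
  have lt_word k : k <= #|G| + num_edges G -> k < 2 ^ w.
    by move=> lek; apply: leq_trans ltW; rewrite ltnS leqW.
  rewrite inputE; apply/and3P; split; [exact/lt_word/leq_addr | exact/lt_word/leq_addl |].
  apply/allP => k /flattenP[_ /mapP[v _ ->]]; rewrite inE => /predU1P[->|/mapP[u _ ->]].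
    by apply/lt_word/(leq_trans (size_adjacency NP v))/leq_addr.
  by apply/lt_word/(leq_trans (ltnW (rank_lt u)))/leq_addr.
have [lta|gea] := ltnP a (size (graph_input N)); first by move/(all_nthP 0); apply.
by rewrite nth_default // expn_gt0.
Qed.

Theorem theorem6p9 :
  decidable_in_time (induced_minor butterfly) (fun n m => n ^ 5 * (n + m)).
Proof.
(* Three times the logarithm suffices because addresses stay below
   2 n ^ 2 + 2 n + 2 <= (n + 2) ^ 3; and 692 = 605 + 87, for the search and for
   reading the input. *)
exists (code 0 butterfly_cmd), 3, 692 => G N NP.
set w := word_size 3 G; set P := code 0 butterfly_cmd.
have ltW := word_size_large G.
have [w_gt0 W_large] : 0 < w /\ #|G| * #|G| + (#|G| + 2) + #|G| * #|G| + #|G| < 2 ^ w.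
  split; first by rewrite /w /word_size muln_gt0 up_log_gt0.
  apply: leq_trans ltW; move: #|G| (num_edges G) => n m.
  by rewrite !expnS expn0; nia.
have match0 : matches 0 (fun=> 0) (nth 0 (graph_input N)) (initial (graph_input N)) by [].
have words0 : words w (fun=> 0) by move=> x; rewrite expn_gt0.
have wordsN : words w (nth 0 (graph_input N)).
  by apply: words_input => //; apply: leq_trans ltW; rewrite expnS leq_pmulr // expn_gt0.
pose Q (t : nat) (R M : store) :=
  t <= 37 + #|G| * (26 + #|G| * 24) + search_cost G /\
  (R vout != 0 <-> induced_minor butterfly G).
have wpQ : wp (2 ^ w) butterfly_cmd Q 0 (fun=> 0) (nth 0 (graph_input N)).
  apply: wp_butterfly_cmd => // t R M let0 Rout; split=> //.
  by rewrite Rout induced_minor_butterflyP.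
have [t [_ [R [M [<- [pcE _ RE] _ _ [let0 Rout]]]]]] :=
  code_sound w_gt0 (code_at_whole P) isT words0 wordsN match0 wpQ.
exists t; split=> [||n_gt0]; first by rewrite /halted pcE.
  by rewrite RE.
apply: (leq_trans let0); apply: (@leq_trans (692 * #|G| ^ 6)).
  have := search_cost_bound n_gt0; move: (search_cost G) #|G| n_gt0 => s n n_gt0.
  have : 37 + n * (26 + n * 24) <= 87 * n ^ 6.
    apply: (@leq_trans (87 * n ^ 2)); first by rewrite expnS expn1; nia.
    by rewrite leq_mul2l leq_pexp2l.
  lia.
by rewrite leq_mul2l expnSr leq_mul2l leq_addr !orbT.
Qed.
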